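(* Let $X$ be a compact Hausdorff space and $\mathcal{E}$ a subhomogeneous (F) Banach bundle over $X$, conditionally of finite type, and such that for every $d$ the set $X_{\le d}:=\{x\in X : \dim\mathcal{E}_x\le d\}$ is a $G_\delta$ subset of $X$. Then for every (possibly degenerate) Banach $C(X)$-module $E$, every $C(X)$-module morphism $\Gamma(\mathcal{E})\to E$ is automatically continuous.
   Context: An (H) Banach bundle over $X$ is a continuous open surjection $\pi:\mathcal{E}\to X$ whose fibers $\mathcal{E}_x:=\pi^{-1}(x)$ are complex Banach spaces, such that: scalar multiplication and fiberwise addition are continuous; the norm $\mathcal{E}\to\mathbb{R}$ is upper semicontinuous; and for every $x\in X$ the sets $\{s : \pi(s)\in U,\ \|s\|<\varepsilon\}$ ($U$ a neighborhood of $x$, $\varepsilon>0$) form a fundamental system of neighborhoods of $0_x\in\mathcal{E}_x$. It is (F) if moreover the norm is continuous. $\Gamma(\mathcal{E})$ is the Banach $C(X)$-module of continuous sections with the supremum norm. $\mathcal{E}$ is subhomogeneous if $\sup_x\dim\mathcal{E}_x<\infty$. Writing $X_d:=\{x : \dim\mathcal{E}_x=d\}$, a subhomogeneous $\mathcal{E}$ is conditionally of finite type if for each $d$ the space $X_d$ has a finite cover by (relatively) open sets $U$ over each of which $\mathcal{E}$ is trivial, i.e. $\mathcal{E}|_U\cong U\times E_0$ via a fiberwise linear homeomorphism over $U$, for a Banach space $E_0$. A $G_\delta$ set is a countable intersection of open sets. A Banach $C(X)$-module is a Banach space $E$ with a $C(X)$-module structure satisfying $\|fv\|\le\|f\|\,\|v\|$;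 it is non-degenerate if the span of $\{fv\}$ is dense (equivalently, if it is unital), and ''possibly degenerate'' means this is not required. Module morphisms are $\mathbb{C}$-linear, $C(X)$-linear maps with no continuity assumed. *)

(* Defs.v *)
From HB Require Import structures.
From mathcomp Require Import all_boot all_order all_algebra complex.
From mathcomp Require Import all_classical all_reals all_analysis.

Set Implicit Arguments.
Unset Strict Implicit.
Unset Printing Implicit Defensive.

Import Order.TTheory GRing.Theory Num.Theory.
Import numFieldNormedType.Exports.
Local Open Scope classical_set_scope.
Local Open Scope ring_scope.
Local Open Scope complex_scope.

(* The norm of a normed module over [R[i]] takes its values in [R[i]], where
   suprema are not available; [rnorm] is the same norm with values in [R]. *)
Definition rnorm (R : realType) (V : normedModType R[i]) (v : V) : R :=
  complex.Re `|v|.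

Section rnorm_theory.
Context {R : realType} {V : normedModType R[i]}.
Implicit Types v w : V.

Lemma rnormE v : (rnorm v)%:C = `|v|.
Proof. by rewrite /rnorm RRe_real// normr_real. Qed.

Lemma rnorm_ge0 v : 0 <= rnorm v.
Proof. by rewrite -lecR rnormE normr_ge0. Qed.

Lemma rnorm0 : rnorm (0 : V) = 0.
Proof. by rewrite /rnorm normr0. Qed.

Lemma rnorm_eq0 v : rnorm v = 0 -> v = 0.
Proof. by move=> v0; apply/normr0_eq0; rewrite -rnormE v0. Qed.

Lemma rnormD v w : rnorm (v + w) <= rnorm v + rnorm w.
Proof. by rewrite -lecR rmorphD/= !rnormE ler_normD. Qed.

Lemma rnormZ (c : R[i]) v : rnorm (c *: v) = rnorm (c : R[i]^o) * rnorm v.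
Proof. by apply: (@complexI R); rewrite rmorphM/= !rnormE normrZ. Qed.

End rnorm_theory.

Section continuous_functions.
Context {R : realType} {X : topologicalType}.

Local Notation CX := (continuousType X R[i]^o).

Definition is_cts : {pred X -> R[i]^o} := fun f => `[<continuous f>].

Lemma is_cts_subring : subring_closed is_cts.
Proof.
split=> [|f g /asboolP cf /asboolP cg|f g /asboolP cf /asboolP cg];
  apply/asboolP => x.
- exact: cvg_cst.
- by apply: cvgB; [exact: cf|exact: cg].
- by apply: cvgM; [exact: cf|exact: cg].
Qed.

HB.instance Definition _ :=
  GRing.isSubringClosed.Build (X -> R[i]^o) is_cts is_cts_subring.

Lemma is_cts_scaler : scaler_closed is_cts.
Proof.
move=> c f /asboolP cf; apply/asboolP => x.
by apply: cvgZr; exact: cf.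
Qed.

HB.instance Definition _ :=
  GRing.isScaleClosed.Build R[i] (X -> R[i]^o) is_cts is_cts_scaler.

Definition cts_Sub (f : X -> R[i]^o) (cf : f \in is_cts) : CX :=
  mkcts (asboolW cf).

Lemma cts_Sub_rect (K : CX -> Type) :
  (forall f cf, K (@cts_Sub f cf)) -> forall u, K u.
Proof.
move=> Ksub u; have cu : (u : X -> R[i]^o) \in is_cts.
  by apply/asboolP; exact: cts_fun.
suff -> : u = cts_Sub cu by exact: Ksub.
exact/continuousEP.
Qed.

Lemma cts_SubK (f : X -> R[i]^o) (cf : f \in is_cts) :
  cts_Sub cf = f :> (X -> R[i]^o).
Proof. by []. Qed.

HB.instance Definition _ := isSub.Build _ _ CX cts_Sub_rect cts_SubK.

HB.instance Definition _ :=
  GRing.SubChoice_isSubComPzRing.Build _ _ CX (GRing.subringClosedP _).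
HB.instance Definition _ := [SubZmodule_isSubLmodule of CX by <:].

(* [sup] has a junk value on unbounded sets: this is the supremum norm only for
   bounded [f], hence for all [f] when [X] is compact. *)
Definition sup_norm (f : CX) : R := sup [set rnorm (f x) | x in [set: X]].

End continuous_functions.

(* The fibre of [bproj] over [x] is identified with the Banach space
   [fiber x] by the bijection [bpoint] from the disjoint union of the Banach
   spaces onto the total space; the topology of [bspace] is unrelated to the
   topology that the library puts on sigma types. *)
Record bundle_data (R : realType) (X : topologicalType) := BundleData {
  bspace : topologicalType;
  fiber : X -> completeNormedModType R[i];
  bpoint : {x : X & fiber x} -> bspace;
  bcoord : bspace -> {x : X & fiber x};
  bpointK : cancel bpoint bcoord;
  bcoordK : cancel bcoord bpoint
}.

Section bundle_operations.
Context {R : realType} {X : topologicalType} (E : bundle_data R X).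

Definition at_fiber (x : X) (v : fiber E x) : bspace E :=
  bpoint (existT (fiber E) x v).

Definition bproj (e : bspace E) : X := tag (bcoord e).

Definition bnorm (e : bspace E) : R := rnorm (tagged (bcoord e)).

Definition bscale (c : R[i]) (e : bspace E) : bspace E :=
  at_fiber (c *: tagged (bcoord e)).

(* Only meaningful on pairs in the same fibre: there [tagged_as] is the
   transport of the second vector to the fibre of the first one. *)
Definition badd (p : bspace E * bspace E) : bspace E :=
  at_fiber (tagged (bcoord p.1) + tagged_as (bcoord p.1) (bcoord p.2)).

Lemma bproj_at (x : X) (v : fiber E x) : bproj (at_fiber v) = x.
Proof. by rewrite /bproj /at_fiber bpointK. Qed.

Lemma bnorm_at (x : X) (v : fiber E x) : bnorm (at_fiber v) = rnorm v.
Proof. by rewrite /bnorm /at_fiber bpointK. Qed.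

Lemma bscale_at c (x : X) (v : fiber E x) :
  bscale c (at_fiber v) = at_fiber (c *: v).
Proof. by rewrite /bscale {2}/at_fiber bpointK. Qed.

Lemma badd_at (x : X) (v w : fiber E x) :
  badd (at_fiber v, at_fiber w) = at_fiber (v + w).
Proof.
rewrite /badd /= {2 3 4}/at_fiber !bpointK /=.
by rewrite -[existT _ x w]/(Tagged (fiber E)
  (w : fiber E (tag (existT (fiber E) x v)))) tagged_asE.
Qed.

End bundle_operations.

(* The (H) bundles of Dupre and Gillette, whose norm is only upper
   semicontinuous; in the (F) bundles below it is continuous. *)
Record banach_bundle (R : realType) (X : topologicalType) := BanachBundle {
  bdata :> bundle_data R X;
  bproj_cts : continuous (@bproj R X bdata);
  bproj_open :
    forall O : set (bspace bdata), open O -> open (@bproj R X bdata @` O);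
  bproj_surj : forall x : X, exists e : bspace bdata, bproj e = x;
  bscale_cts :
    continuous (fun z : R[i]^o * bspace bdata => bscale z.1 z.2);
  badd_cts :
    {within [set p | bproj p.1 = bproj p.2], continuous (@badd R X bdata)};
  bnorm_usc : forall (e : bspace bdata) (a : R),
    bnorm e < a -> \forall e' \near e, bnorm e' < a;
  nbhs_zero : forall (x : X) (A : set (bspace bdata)),
    nbhs (at_fiber (0 : fiber bdata x)) A <->
    exists (U : set X) (eps : R), [/\ nbhs x U, 0 < eps &
      [set e | U (bproj e) /\ bnorm e < eps] `<=` A]
}.

Definition is_F_bundle (R : realType) (X : topologicalType)
  (E : banach_bundle R X) : Prop := continuous (@bnorm R X E).

Section dimension.
Context {R : realType} {X : topologicalType} (E : banach_bundle R X).

Definition has_dim (K : fieldType) (V : lmodType K) (d : nat) : Prop :=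
  exists b : 'I_d -> V, forall v : V,
    exists! c : 'rV[K]_d, v = \sum_(i < d) c 0 i *: b i.

Definition dim_eq_set (d : nat) : set X := [set x | has_dim (fiber E x) d].

Definition dim_le_set (d : nat) : set X :=
  [set x | exists2 k, (k <= d)%N & has_dim (fiber E x) k].

Definition subhomogeneous : Prop := exists N, forall x, dim_le_set N x.

(* [Phi] and [Psi] are mutually inverse homeomorphisms between [E|_U] and
   [U * E0]; their values outside of these subspaces are irrelevant. *)
Definition trivial_over (U : set X) : Prop :=
  exists (E0 : completeNormedModType R[i])
    (Phi : bspace E -> X * E0) (Psi : X * E0 -> bspace E),
  [/\ {within [set e | U (bproj e)], continuous Phi} /\
      {within [set z | U z.1], continuous Psi},
      forall e, U (bproj e) -> Psi (Phi e) = e,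
      forall z, U z.1 -> U (bproj (Psi z)) /\ Phi (Psi z) = z,
      forall e, U (bproj e) -> (Phi e).1 = bproj e &
      forall x, U x -> linear (fun v : fiber E x => (Phi (at_fiber v)).2)].

Definition conditionally_finite_type : Prop :=
  forall d, exists (n : nat) (U : 'I_n -> set X),
  [/\ forall i, exists2 O, open O & U i = dim_eq_set d `&` O,
      dim_eq_set d `<=` \bigcup_(i in [set: 'I_n]) U i &
      forall i, trivial_over (U i)].

End dimension.

Record csection (R : realType) (X : topologicalType) (E : banach_bundle R X) :=
  CSection {
    section_fun :> forall x : X, fiber E x;
    section_cts : continuous (fun x => at_fiber (section_fun x))
  }.

Section csection_lmodule.
Context {R : realType} {X : topologicalType} {E : banach_bundle R X}.
Implicit Types (s t : csection E) (f : continuousType X R[i]^o).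

HB.instance Definition _ := gen_eqMixin (csection E).
HB.instance Definition _ := gen_choiceMixin (csection E).

Lemma csectionP s t : (forall x, s x = t x) -> s = t.
Proof.
case: s t => [s cs] [t ct]/= st.
have {}st : s = t by exact/functional_extensionality_dep.
by rewrite st in cs *; congr CSection; exact: Prop_irrelevance.
Qed.

Lemma zero_cts : continuous (fun x => at_fiber (0 : fiber E x)).
Proof.
move=> x A /nbhs_zero[U [e [Ux e0 UA]]].
apply: filterS Ux => y Uy; apply: UA => /=.
by rewrite bproj_at bnorm_at rnorm0.
Qed.

Lemma scale_cts f s : continuous (fun x => at_fiber (f x *: s x)).
Proof.
rewrite (_ : (fun x => _) = (fun z : R[i]^o * bspace E => bscale z.1 z.2) \o
    (fun x => (f x, at_fiber (s x)))); last first.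
  by apply/funext => x /=; rewrite bscale_at.
move=> x; apply: continuous_comp; last exact: bscale_cts.
exact: (cvg_pair (@cts_fun _ _ f x) (@section_cts _ _ _ s x)).
Qed.

Lemma add_cts s t : continuous (fun x => at_fiber (s x + t x)).
Proof.
pose g x := (at_fiber (s x), at_fiber (t x)).
rewrite (_ : (fun x => _) = @badd R X E \o g); last first.
  by apply/funext => x /=; rewrite badd_at.
have pg y : bproj (g y).1 = bproj (g y).2 by rewrite !bproj_at.
move=> x A /= /((subspace_continuousP _ _).1 (@badd_cts _ _ E) (g x) (pg x)).
move/(cvg_pair (@section_cts _ _ _ s x) (@section_cts _ _ _ t x)).
move=> nA; apply: (@filterS _ _ (nbhs_filter x) _ _ _ nA) => y.
exact: (fun h => h (pg y)).
Qed.

Definition csection0 : csection E := CSection zero_cts.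
Definition csection_add s t : csection E := CSection (@add_cts s t).
Definition csection_mul f s : csection E := CSection (@scale_cts f s).
Definition csection_scale (c : R[i]) s : csection E :=
  csection_mul (mkcts (@cst_continuous X R[i]^o c)) s.
Definition csection_opp s : csection E := csection_scale (-1) s.

Lemma csection_addA : associative csection_add.
Proof. by move=> s t u; apply: csectionP => x /=; rewrite addrA. Qed.

Lemma csection_addC : commutative csection_add.
Proof. by move=> s t; apply: csectionP => x /=; rewrite addrC. Qed.

Lemma csection_add0 : left_id csection0 csection_add.
Proof. by move=> s; apply: csectionP => x /=; rewrite add0r. Qed.

Lemma csection_addN : left_inverse csection0 csection_opp csection_add.
Proof.
by move=> s; apply: csectionP => x /=; rewrite scaleN1r addNr.
Qed.

HB.instance Definition _ := GRing.isZmodule.Build (csection E)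
  csection_addA csection_addC csection_add0 csection_addN.

Lemma csection_scaleA a b s :
  csection_scale a (csection_scale b s) = csection_scale (a * b) s.
Proof. by apply: csectionP => x /=; rewrite scalerA. Qed.

Lemma csection_scale1 : left_id 1 csection_scale.
Proof. by move=> s; apply: csectionP => x /=; rewrite scale1r. Qed.

Lemma csection_scaleDr : right_distributive csection_scale +%R.
Proof. by move=> a s t; apply: csectionP => x /=; rewrite scalerDr. Qed.

Lemma csection_scaleDl s :
  {morph csection_scale^~ s : a b / a + b >-> a + b}.
Proof. by move=> a b; apply: csectionP => x /=; rewrite scalerDl. Qed.

HB.instance Definition _ := GRing.Zmodule_isLmodule.Build R[i] (csection E)
  csection_scaleA csection_scale1 csection_scaleDr csection_scaleDl.

Lemma csectionD s t x : (s + t) x = s x + t x. Proof. by []. Qed.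

Lemma csectionZ (c : R[i]) s x : (c *: s) x = c *: s x. Proof. by []. Qed.

End csection_lmodule.

(* The compactness of the base space is recorded in the type since it is what
   makes the supremum below a norm. *)
Definition Gamma (R : realType) (X : topologicalType)
  (cX : compact [set: X]) (E : banach_bundle R X) : Type := csection E.

Section Gamma_normed.
Context {R : realType} {X : topologicalType} (cX : compact [set: X])
  (E : banach_bundle R X).
Implicit Types s t : Gamma cX E.

HB.instance Definition _ := GRing.Lmodule.on (Gamma cX E).

Definition Gamma_norm (s : Gamma cX E) : R :=
  sup [set rnorm ((s : csection E) x) | x in [set: X]].

Lemma section_bounded s :
  has_ubound [set rnorm ((s : csection E) x) | x in [set: X]].
Proof.
pose P (M : R) x := rnorm ((s : csection E) x) < M.
have : \forall M \near +oo, [set: X] `<=` P M.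
  apply: (compact_near_coveringP _).1 => // x _.
  have /bnorm_usc ux : bnorm (at_fiber ((s : csection E) x)) <
      rnorm ((s : csection E) x) + 1.
    by rewrite bnorm_at ltrDl.
  have {}ux := @section_cts _ _ _ s x _ ux.
  exists ([set y | rnorm ((s : csection E) y) < rnorm ((s : csection E) x) + 1],
    [set M | rnorm ((s : csection E) x) + 1 <= M]) => /=.
    split; last exact: (nbhs_pinfty_ge (num_real _)).
    apply: (@filterS _ _ (nbhs_filter x) _ _ _ ux) => y.
    by rewrite /= bnorm_at.
  by move=> [y M]/= [yM]; exact: lt_le_trans.
move=> /filter_ex[M PM].
by exists M => _ [x _ <-]; apply/ltW/PM.
Qed.

Lemma rnorm_le_Gamma_norm s x : rnorm ((s : csection E) x) <= Gamma_norm s.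
Proof. by apply: ub_le_sup; [exact: section_bounded|exists x]. Qed.

Lemma Gamma_norm_le s (M : R) : 0 <= M ->
  (forall x, rnorm ((s : csection E) x) <= M) -> Gamma_norm s <= M.
Proof.
move=> M0 sM; rewrite /Gamma_norm.
have [->|/set0P ne] := eqVneq [set rnorm ((s : csection E) x) | x in setT] set0.
  by rewrite sup0.
by apply: ge_sup => // _ [x _ <-].
Qed.

Lemma Gamma_norm_ge0 s : 0 <= Gamma_norm s.
Proof.
rewrite /Gamma_norm.
have [->|/set0P[_ [x _ _]]] :=
  eqVneq [set rnorm ((s : csection E) x) | x in setT] set0.
  by rewrite sup0.
exact: le_trans (rnorm_ge0 _) (rnorm_le_Gamma_norm s x).
Qed.

Lemma Gamma_normD s t :
  (Gamma_norm (s + t))%:C <= (Gamma_norm s)%:C + (Gamma_norm t)%:C.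
Proof.
rewrite -rmorphD lecR; apply: Gamma_norm_le => [|x].
  by rewrite addr_ge0 ?Gamma_norm_ge0.
by rewrite (le_trans (rnormD _ _))// lerD ?rnorm_le_Gamma_norm.
Qed.

Lemma Gamma_normZ_le (c : R[i]) s :
  Gamma_norm (c *: s) <= rnorm (c : R[i]^o) * Gamma_norm s.
Proof.
apply: Gamma_norm_le => [|x].
  by rewrite mulr_ge0 ?rnorm_ge0 ?Gamma_norm_ge0.
rewrite [X in rnorm X]csectionZ rnormZ.
by rewrite ler_wpM2l ?rnorm_ge0 ?rnorm_le_Gamma_norm.
Qed.

Lemma Gamma_normZ (c : R[i]) s :
  (Gamma_norm (c *: s))%:C = `|c| * (Gamma_norm s)%:C.
Proof.
have -> : `|c| = (rnorm (c : R[i]^o))%:C by rewrite rnormE.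
rewrite -rmorphM; congr (_%:C); apply/eqP; rewrite eq_le Gamma_normZ_le/=.
have [->|c0] := eqVneq c 0; first by rewrite rnorm0 mul0r Gamma_norm_ge0.
have rc : 0 < rnorm (c : R[i]^o) by rewrite -ltcR rnormE normr_gt0.
rewrite mulrC -ler_pdivlMr// mulrC.
have := Gamma_normZ_le c^-1 (c *: s); rewrite scalerA mulVf// scale1r.
suff -> : rnorm (c^-1 : R[i]^o) = (rnorm (c : R[i]^o))^-1 by [].
by apply: (@complexI R); rewrite fmorphV/= !rnormE normfV.
Qed.

Lemma Gamma_norm_eq0 s : (Gamma_norm s)%:C = 0 -> s = 0.
Proof.
move=> /(@complexI R _ 0) s0; apply: csectionP => x; apply: rnorm_eq0.
by apply/eqP; rewrite eq_le rnorm_ge0 andbT -s0 rnorm_le_Gamma_norm.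
Qed.

HB.instance Definition _ := Lmodule_isNormed.Build R[i] (Gamma cX E)
  Gamma_normD Gamma_normZ Gamma_norm_eq0.

Definition Gamma_mul (f : continuousType X R[i]^o) (s : Gamma cX E) :
  Gamma cX E := csection_mul f s.

End Gamma_normed.

(* There is no axiom [mod_act 1 v = v], so that the module may be degenerate. *)
Record banach_module (R : realType) (X : topologicalType)
    (V : completeNormedModType R[i]) := BanachModule {
  mod_act : continuousType X R[i]^o -> V -> V;
  mod_act_linearl : forall v, linear (mod_act^~ v);
  mod_act_linearr : forall f, linear (mod_act f);
  mod_actM : forall f g v, mod_act (f * g) v = mod_act f (mod_act g v);
  mod_act_norm : forall f v, rnorm (mod_act f v) <= sup_norm f * rnorm v
}.

(* Main.v *)
Require Import Defs.
From HB Require Import structures.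
From mathcomp Require Import all_boot all_order all_algebra complex.
From mathcomp Require Import all_classical all_reals all_analysis borel_hierarchy.
From mathcomp Require Import ring lra.

Set Implicit Arguments.
Unset Strict Implicit.
Unset Printing Implicit Defensive.

Import Order.TTheory GRing.Theory Num.Theory.
Import numFieldNormedType.Exports.
Local Open Scope classical_set_scope.
Local Open Scope ring_scope.
Local Open Scope complex_scope.

(* Say that phi is bounded on a set Z if |phi s| <= B |s| for the sections s
   vanishing on Z.  Trivially phi is bounded on X, and it is continuous iff it is
   bounded on the empty set, so it suffices to pass from a closed set K to Z
   when E has a frame of size d over K \ Z.  Were phi unbounded on Z, there
   would be sections u_n vanishing on Z with |u_n| = 2^(-(d+1)n) and
   |phi u_n| > n.  Put h^2 = sum_n 2^(dn) |u_n|.  Where h > 0 on K, induction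
   on the length of the frame gives u_n/h = sum_(j<d) f_nj t_j with d sections
   t_j = O(h) independent of n and uniformly bounded scalars f_nj; so h f_nj and
   t_j extend by 0 to K, and then to X by Tietze's theorem and its analogue
   for sections.  Thus, up to a section vanishing on K, every u_n is a
   combination of d fixed sections with bounded coefficients, and phi u_n is
   bounded: a contradiction.  Continuity of the norm makes the sets of points
   with fibres of dimension < d closed, and finitely many such steps lead from
   each of them to the next smaller one. *)

(** * The real-valued norm on vectors and on scalars *)

Section rnorm_extra.
Context {R : realType} {V : normedModType R[i]}.
Implicit Types v w : V.

Lemma rnormN v : rnorm (- v) = rnorm v.
Proof. by rewrite /rnorm normrN. Qed.

Lemma rnormB_le v w : rnorm (v - w) <= rnorm v + rnorm w.
Proof. by rewrite (le_trans (rnormD _ _))// rnormN. Qed.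

Lemma rdistC v w : rnorm (v - w) = rnorm (w - v).
Proof. by rewrite -rnormN opprB. Qed.

Lemma rnorm_dist_le v w : `|rnorm v - rnorm w| <= rnorm (v - w).
Proof.
rewrite ler_norml; apply/andP; split.
  by rewrite lerNl opprB lerBlDr rdistC (le_trans _ (rnormD _ _))// subrK.
by rewrite lerBlDr (le_trans _ (rnormD _ _))// subrK.
Qed.

Lemma rnorm_sum_le (I : Type) (r : seq I) (P : pred I) (F : I -> V) :
  rnorm (\sum_(i <- r | P i) F i) <= \sum_(i <- r | P i) rnorm (F i).
Proof.
elim/big_rec2: _ => [|i x y _ h]; first by rewrite rnorm0.
by rewrite (le_trans (rnormD _ _))// lerD2l.
Qed.

Lemma rnorm_gt0 v : (0 < rnorm v) = (v != 0).
Proof.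
rewrite lt_neqAle rnorm_ge0 andbT eq_sym; congr (~~ _).
by apply/eqP/eqP => [/rnorm_eq0//|->]; rewrite rnorm0.
Qed.

Lemma cvg_rnormP {T : Type} {F : set_system T} {FF : Filter F} (f : T -> V) (l : V) :
  f @ F --> l <-> forall e : R, 0 < e -> \forall y \near F, rnorm (f y - l) < e.
Proof.
split=> [/cvgrPdist_lt fl e e0|fl].
  have := fl e%:C; rewrite ltcR => /(_ e0).
  by apply: filterS => y; rewrite -rnormE ltcR rdistC.
apply/cvgrPdist_lt => e e0.
have er : e = (complex.Re e)%:C by rewrite RRe_real// gtr0_real.
move: e0; rewrite er ltcR => /fl; apply: filterS => y.
by rewrite -rnormE ltcR rdistC.
Qed.

End rnorm_extra.

Section rnorm_scalar.
Context {R : realType}.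
Implicit Types (c d : R[i]^o) (r : R).

Lemma rnormM c d : rnorm (c * d : R[i]^o) = rnorm c * rnorm d.
Proof. exact: (rnormZ c d). Qed.

Lemma rnormr r : rnorm (r%:C : R[i]^o) = `|r|.
Proof.
by apply: (@complexI R); rewrite rnormE normc_def/= expr0n/= addr0 sqrtr_sqr.
Qed.

Lemma rnormV c : rnorm (c^-1 : R[i]^o) = (rnorm c)^-1.
Proof. by apply: (@complexI R); rewrite fmorphV/= !rnormE normfV. Qed.

Lemma rnorm_conj c : rnorm (c^*%C : R[i]^o) = rnorm c.
Proof. by rewrite /rnorm; congr complex.Re; case: c => a b; rewrite !normc_def/= sqrrN. Qed.

Lemma mul_conj_rnorm c : c^*%C * c = ((rnorm c) ^+ 2)%:C.
Proof.
case: c => a b; rewrite /rnorm normc_def /= sqr_sqrtr ?addr_ge0 ?sqr_ge0//.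
by apply/eqP; rewrite eq_complex /=; apply/andP; split; apply/eqP; ring.
Qed.

Lemma rnorm_Re_le c : `|complex.Re c| <= rnorm c.
Proof.
case: c => a b; rewrite /rnorm normc_def/= -sqrtr_sqr.
by rewrite ler_sqrt ?lerDl ?sqr_ge0// addr_ge0 ?sqr_ge0.
Qed.

Lemma rnorm_Im_le c : `|complex.Im c| <= rnorm c.
Proof.
case: c => a b; rewrite /rnorm normc_def/= -sqrtr_sqr.
by rewrite ler_sqrt ?lerDr ?sqr_ge0// addr_ge0 ?sqr_ge0.
Qed.

Lemma rnorm_le_ReIm c : rnorm c <= `|complex.Re c| + `|complex.Im c|.
Proof.
case: c => a b; rewrite /rnorm normc_def/= -[leRHS]ger0_norm ?addr_ge0//.
rewrite -sqrtr_sqr ler_sqrt ?sqr_ge0// sqrrD !real_normK ?num_real//.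
by rewrite -addrA lerD2l lerDr mulrn_wge0// mulr_ge0.
Qed.

End rnorm_scalar.

(** * Convergence of sections along a filter *)

Section section_convergence.
Context {R : realType} {X : topologicalType} (E : banach_bundle R X).

(** Values at different points lie in different fibres, so convergence takes place in the total
    space; continuity of [bproj] then forces [F] to converge to [x]. *)
Definition scvg (F : set_system X) (f : forall y, fiber E y) (x : X)
  (v : fiber E x) : Prop := (fun y => at_fiber (f y)) @ F --> at_fiber v.

Context {F : set_system X} {FF : Filter F}.
Implicit Types (f g : forall y, fiber E y) (x : X).

Lemma scvg_base f x (v : fiber E x) : scvg F f v -> F `=>` nbhs x.
Proof.
move=> fv A Ax.
have h := cvg_comp _ _ fv (@bproj_cts _ _ E (at_fiber v)).
rewrite bproj_at in h; apply: (@filterS _ F _ _ _ _ (h A Ax)) => y /=.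
by rewrite bproj_at.
Qed.

Lemma scvg0 f x : F `=>` nbhs x ->
  (forall e : R, 0 < e -> \forall y \near F, rnorm (f y) < e) ->
  scvg F f (0 : fiber E x).
Proof.
move=> Fx f0 A /nbhs_zero[U [e [Ux e0 UA]]].
have h : \forall y \near F, U y /\ rnorm (f y) < e.
  by apply: filterI; [exact: Fx|exact: f0].
apply: (@filterS _ F _ _ _ _ h) => y [Uy ye]; apply: UA.
by rewrite /= bproj_at bnorm_at.
Qed.

Lemma scvgD f g x (v w : fiber E x) : scvg F f v -> scvg F g w ->
  scvg F (fun y => f y + g y) (v + w).
Proof.
move=> fv gw; rewrite /scvg -badd_at.
pose h y := (at_fiber (f y), at_fiber (g y)).
have hE y : at_fiber (f y + g y) = badd (h y) by rewrite badd_at.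
have pg y : bproj (h y).1 = bproj (h y).2 by rewrite !bproj_at.
move=> A /=.
have pw : bproj (at_fiber v) = bproj (at_fiber w) by rewrite !bproj_at.
move/((subspace_continuousP _ _).1 (@badd_cts _ _ E) (_, _) pw).
move/(cvg_pair fv gw) => h1; apply: (@filterS _ F _ _ _ _ h1) => y.
by rewrite /= hE => /(_ (pg y)).
Qed.

Lemma scvgZ (a : X -> R[i]^o) (c : R[i]^o) f x (v : fiber E x) :
  a @ F --> c -> scvg F f v -> scvg F (fun y => a y *: f y) (c *: v).
Proof.
move=> ac fv; rewrite /scvg -bscale_at.
have := @bscale_cts _ _ E (c, at_fiber v).
move=> h A /h /(cvg_pair ac fv) => h1; apply: (@filterS _ F _ _ _ _ h1) => y /=.
by rewrite bscale_at.
Qed.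

Lemma scvgN f x (v : fiber E x) : scvg F f v -> scvg F (fun y => - f y) (- v).
Proof.
move=> fv; rewrite -scaleN1r (_ : (fun y => - f y) = fun y => -1 *: f y).
  by apply: scvgZ => //; exact: cvg_cst.
by apply: functional_extensionality_dep => y; rewrite scaleN1r.
Qed.

Lemma scvgB f g x (v w : fiber E x) : scvg F f v -> scvg F g w ->
  scvg F (fun y => f y - g y) (v - w).
Proof. by move=> fv gw; apply: scvgD => //; exact: scvgN. Qed.

(** Convergence of [F] to [x] is assumed because an empty sum has no summand to provide it. *)
Lemma scvg_sum (I : Type) (r : seq I) (f : I -> forall y, fiber E y) x
    (v : I -> fiber E x) : F `=>` nbhs x ->
  (forall i, scvg F (f i) (v i)) ->
  scvg F (fun y => \sum_(i <- r) f i y) (\sum_(i <- r) v i).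
Proof.
move=> Fx fv; elim: r => [|i r ih].
  rewrite big_nil; apply: scvg0 => // e e0; apply: nearW => y.
  by rewrite big_nil rnorm0.
rewrite big_cons (_ : (fun y => _) = fun y => f i y + \sum_(j <- r) f j y).
  exact: scvgD.
by apply: functional_extensionality_dep => y; rewrite big_cons.
Qed.

Lemma scvg_near f g x (v : fiber E x) : (\forall y \near F, f y = g y) ->
  scvg F f v -> scvg F g v.
Proof.
move=> fg fv A /fv Av.
by apply: (@filterS2 _ F _ _ _ _ _ fg Av) => y /= ->.
Qed.

Lemma scvg_dist f g x (v : fiber E x) : scvg F f v ->
  (forall e : R, 0 < e -> \forall y \near F, rnorm (g y - f y) < e) ->
  scvg F g v.
Proof.
move=> fv fg.
apply: (@scvg_near (fun y => f y + (g y - f y))).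
  by apply: nearW => y; rewrite addrC subrK.
by rewrite -[v]addr0; apply: scvgD => //; apply: scvg0 => //; apply: scvg_base fv.
Qed.

Lemma scvg_usc f x (v : fiber E x) (a : R) : scvg F f v -> rnorm v < a ->
  \forall y \near F, rnorm (f y) < a.
Proof.
move=> fv; rewrite -bnorm_at => /bnorm_usc /fv => h.
by apply: (@filterS _ F _ _ _ _ h) => y /=; rewrite bnorm_at.
Qed.

Lemma scvg_norm f x (v : fiber E x) : is_F_bundle E -> scvg F f v ->
  (fun y => rnorm (f y)) @ F --> rnorm v.
Proof.
move=> EF fv; rewrite -bnorm_at.
have h := cvg_comp _ _ fv (EF (at_fiber v)).
suff -> : (fun y => rnorm (f y)) = (fun y => bnorm (at_fiber (f y))) by exact: h.
by apply/funext => y; rewrite bnorm_at.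
Qed.

End section_convergence.

Lemma scvg_sub {R : realType} {X : topologicalType} (E : banach_bundle R X)
    (F G : set_system X) (f : forall y, fiber E y) x (v : fiber E x) :
  G `=>` F -> scvg F f v -> scvg G f v.
Proof. by move=> GF fv A /fv; apply: GF. Qed.

Lemma cvg_real_complex {R : realType} {T : Type} {F : set_system T}
    {FF : Filter F} (f : T -> R) (l : R) :
  f @ F --> l -> (fun t => (f t)%:C : R[i]^o) @ F --> (l%:C : R[i]^o).
Proof.
move=> /cvgrPdist_lt fl; apply/cvg_rnormP => e /fl; apply: filterS => y.
by rewrite -rmorphB rnormr distrC.
Qed.

Lemma cvg_sum {K : numFieldType} {V : normedModType K} {T I : Type}
    {F : set_system T} {FF : Filter F} (r : seq I) (f : I -> T -> V) (l : I -> V) :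
  (forall i, f i @ F --> l i) ->
  (fun t => \sum_(i <- r) f i t) @ F --> \sum_(i <- r) l i.
Proof.
move=> fl; elim: r => [|i r ih].
  by rewrite big_nil; under eq_fun do rewrite big_nil; exact: cvg_cst.
by rewrite big_cons; under eq_fun do rewrite big_cons; exact: cvgD.
Qed.
Lemma at_fiber_bcoord {R : realType} {X : topologicalType} (E : bundle_data R X)
  (e : bspace E) : at_fiber (tagged (bcoord e)) = e.
Proof. by rewrite /at_fiber -[RHS]bcoordK; case: (bcoord e). Qed.

(** * Neighbourhoods of a vector in the total space *)

Section fiber_neighbourhoods.
Context {R : realType} {X : topologicalType} (E : banach_bundle R X).
Implicit Types (x y : X) (Q : forall y, fiber E y -> Prop).

(** A neighbourhood in the total space is written as a predicate on the vectors of all fibres, so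
    that fibrewise algebra applies without transport. *)
Definition bnear x (v : fiber E x) Q : Prop :=
  nbhs (at_fiber v) [set e | Q _ (tagged (bcoord e))].

Lemma bnear_self x (v : fiber E x) Q : bnear v Q -> Q x v.
Proof. by move=> /nbhs_singleton /=; rewrite /at_fiber bpointK. Qed.

Lemma bnearS x (v : fiber E x) Q Q' :
  (forall y w, Q y w -> Q' y w) -> bnear v Q -> bnear v Q'.
Proof. by move=> QQ'; apply: filterS => e; apply: QQ'. Qed.

Lemma bnearI x (v : fiber E x) Q Q' : bnear v Q -> bnear v Q' ->
  bnear v (fun y w => Q y w /\ Q' y w).
Proof. by move=> vQ vQ'; apply: filterI. Qed.

Lemma bnear_interior x (v : fiber E x) Q : bnear v Q ->
  bnear v (fun y w => bnear w Q).
Proof.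
move=> /nbhs_interior; apply: filterS => e; rewrite /bnear /interior /=.
by rewrite at_fiber_bcoord.
Qed.

Lemma scvg_bnear (F : set_system X) {FF : Filter F} f x (v : fiber E x) Q :
  scvg F f v -> bnear v Q -> \forall y \near F, Q y (f y).
Proof.
move=> fv /fv h; apply: (@filterS _ F _ _ _ _ h) => y /=.
by rewrite /at_fiber bpointK.
Qed.

Lemma bnear_scvg (F : set_system X) {FF : Filter F} f x (v : fiber E x) :
  (forall Q, bnear v Q -> \forall y \near F, Q y (f y)) -> scvg F f v.
Proof.
move=> h A Av.
have /h h' : bnear v (fun y w => A (at_fiber w)).
  apply: filterS Av => e /= Ae.
  by rewrite at_fiber_bcoord.
exact: (@filterS _ F _ _ _ _ h').
Qed.

(** Openness of [bproj] enters here: it provides vectors in the nearby fibres when no continuous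
    section through [v] is known yet. *)
Lemma bnear_open x (v : fiber E x) Q : bnear v Q ->
  \forall y \near x, exists w, Q y w.
Proof.
rewrite /bnear nbhsE; case=> W [oW Wv] WQ.
have h : open_nbhs x (@bproj _ _ E @` W).
  by split; [exact: bproj_open|exists (at_fiber v); rewrite ?bproj_at].
apply: filterS (open_nbhs_nbhs h) => y [e We <-].
by exists (tagged (bcoord e)); exact: (WQ e).
Qed.

Lemma bnear_base x (v : fiber E x) (U : set X) : nbhs x U ->
  bnear v (fun y _ => U y).
Proof.
move=> Ux; rewrite -(bproj_at v) in Ux.
exact: (@bproj_cts _ _ E (at_fiber v) U Ux).
Qed.

Lemma bnear_norm x (v : fiber E x) (a : R) : rnorm v < a ->
  bnear v (fun y w => rnorm w < a).
Proof. by rewrite -bnorm_at => /bnorm_usc. Qed.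

Lemma bnear0 x Q : bnear (0 : fiber E x) Q -> exists2 e : R, 0 < e &
  \forall y \near x, forall w, rnorm w < e -> Q y w.
Proof.
move=> /nbhs_zero[U [e [Ux e0 UA]]]; exists e => //.
apply: filterS Ux => y Uy w we; have := UA (at_fiber w).
by rewrite /= bproj_at bnorm_at /at_fiber bpointK; apply.
Qed.

Lemma bnearD x (v w : fiber E x) Q : bnear (v + w) Q ->
  exists Q1 Q2, [/\ bnear v Q1, bnear w Q2 &
    forall y v' w', Q1 y v' -> Q2 y w' -> Q y (v' + w')].
Proof.
rewrite /bnear -badd_at => h.
have pw : bproj (at_fiber v) = bproj (at_fiber w) by rewrite !bproj_at.
have := (subspace_continuousP _ _).1 (@badd_cts _ _ E) (_, _) pw _ h.
move=> [[A B] /= [Av Bw] AB].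
exists (fun y v' => A (at_fiber v')), (fun y w' => B (at_fiber w')); split.
- apply: filterS Av => e /=.
  by rewrite at_fiber_bcoord.
- apply: filterS Bw => e /=.
  by rewrite at_fiber_bcoord.
move=> y v' w' Av' Bw'.
have : Q _ (tagged (bcoord (badd (at_fiber v', at_fiber w')))).
  by apply: (AB (_, _) (conj Av' Bw')); rewrite !bproj_at.
by rewrite badd_at /at_fiber bpointK.
Qed.

Lemma bnearZ (c : R[i]^o) x (v : fiber E x) Q : bnear (c *: v) Q ->
  exists (A : set R[i]^o) Q1, [/\ nbhs c A, bnear v Q1 &
    forall y d w, A d -> Q1 y w -> Q y (d *: w)].
Proof.
rewrite /bnear -bscale_at => h.
have [[A B] /= [Ac Bv] AB] := @bscale_cts _ _ E (c, at_fiber v) _ h.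
exists A, (fun y w' => B (at_fiber w')); split => //.
  apply: filterS Bv => e /=.
  by rewrite at_fiber_bcoord.
move=> y d w Ad Bw; have : Q _ (tagged (bcoord (bscale d (at_fiber w)))).
  exact: (AB (_, _) (conj Ad Bw)).
by rewrite bscale_at /at_fiber bpointK.
Qed.

Lemma bnearN x (v : fiber E x) Q : bnear (- v) Q ->
  bnear v (fun y w => Q y (- w)).
Proof.
rewrite -scaleN1r => /bnearZ[A [Q1 [/nbhs_singleton A1 vQ1 h]]].
by apply: bnearS vQ1 => y w Qw; rewrite -scaleN1r; apply: h.
Qed.

(** Subtraction is continuous at the pair [(v, v)], where its value is 0, and the norm is upper
    semicontinuous. *)
Lemma bnear_tube x (v : fiber E x) (e : R) : 0 < e ->
  exists2 Q, bnear v Q & forall y w1 w2, Q y w1 -> Q y w2 -> rnorm (w1 - w2) < e.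
Proof.
move=> e0; have : bnear (v + - v) (fun y w => rnorm w < e).
  by apply: bnear_norm; rewrite subrr rnorm0.
move=> /bnearD[Q1 [Q2 [h1 /bnearN h2 h]]].
exists (fun y w => Q1 y w /\ Q2 y (- w)); first exact: bnearI.
by move=> y w1 w2 [? _] [_ ?]; apply: h.
Qed.

End fiber_neighbourhoods.

(* [osc_le f a x] says that the discontinuity of the section [f] at [x] is at
   most [a]. *)
Definition osc_le {R : realType} {X : topologicalType} {E : banach_bundle R X}
  (f : forall y, fiber E y) (a : R) (x : X) : Prop :=
  forall e : R, 0 < e -> bnear (f x) (fun y w => rnorm (f y - w) < a + e).

(** * Calculus of the oscillation of discontinuous sections *)

Section oscillation.
Context {R : realType} {X : topologicalType} {E : banach_bundle R X}.
Implicit Types (f g : forall y, fiber E y) (x : X) (a b : R).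

Lemma osc_le_trans f a b x : a <= b -> osc_le f a x -> osc_le f b x.
Proof.
move=> ab fa e /fa; apply: bnearS => y w /lt_le_trans; apply.
by rewrite lerD2r.
Qed.

Lemma osc_leD f g a b x : osc_le f a x -> osc_le g b x ->
  osc_le (fun y => f y + g y) (a + b) x.
Proof.
move=> fa gb e e0.
have e2 : 0 < e / 2 by rewrite divr_gt0.
have := gb _ e2; rewrite -{1}(addKr (f x) (g x)) addrC.
move=> /bnearD[Q1 [Q2 [h1 /bnearN h2 h]]].
(* A vector [w] near [f x + g x] is split as [w1 + (w - w1)]: openness of [bproj] gives [w1] in the
   same fibre near [f x], and then [w - w1] is near [g x]. *)
have h3 := bnear_base (f x + g x) (bnear_open (bnearI (fa _ e2) h2)).
apply: bnearS (bnearI h1 h3) => y w [Q1w [w1 [fw1 Q2w1]]].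
have gw := h _ _ _ Q1w Q2w1.
have -> : f y + g y - w = (f y - w1) + (g y - (w - w1)).
  by rewrite opprB addrACA addKr.
rewrite (le_lt_trans (rnormD _ _))// [e]splitr addrACA ltrD//.
Qed.

Lemma osc_le_bounded f a x : (forall y, rnorm (f y) <= a) -> osc_le f (2 * a) x.
Proof.
move=> fa e e0.
have : rnorm (f x) < a + e by rewrite (le_lt_trans (fa x))// ltrDl.
move/bnear_norm; apply: bnearS => y w h.
rewrite (le_lt_trans (rnormB_le _ _))// mulr2n mulrDl mul1r -addrA.
by rewrite ler_ltD.
Qed.

Lemma osc_le_locally_bounded f a x : osc_le f a x ->
  \forall y \near x, rnorm (f y) <= rnorm (f x) + a + 2.
Proof.
move=> /(_ 1 ltr01) h.
have h1 : rnorm (f x) < rnorm (f x) + 1 by rewrite ltrDl.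
have := bnear_open (bnearI h (bnear_norm h1)).
apply: filterS => y [w [fw w1]].
rewrite -[f y](subrK w) (le_trans (rnormD _ _))//.
lra.
Qed.

(** Where [p x > 0], a vector near [p x *: f x] is divided by [p y] and compared with [f y]; where
    [p x = 0], local boundedness of [f] makes the product small. *)
Lemma osc_leZ (p : X -> R) f a x : p @ x --> p x -> 0 <= p x ->
  (forall y, 0 <= p y) -> osc_le f a x -> 0 <= a ->
  osc_le (fun y => (p y)%:C *: f y) (p x * a) x.
Proof.
move=> pc; rewrite le_eqVlt => /predU1P[px0 p0 fa a0|px p0 fa a0] e e0.
  set M := rnorm (f x) + a + 2.
  have M0 : 0 < M by rewrite /M ltr_wpDl// addr_ge0// rnorm_ge0.
  have e4 : 0 < e / 2 / M by rewrite !divr_gt0.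
  have hM := bnear_base ((p x)%:C *: f x) (osc_le_locally_bounded fa).
  have hp : \forall y \near x, p y < e / 2 / M.
    have /cvgrPdist_lt/(_ _ e4) := pc; apply: filterS => y.
    by rewrite -px0 sub0r normrN => /(le_lt_trans (ler_norm _)).
  have hw : rnorm ((p x)%:C *: f x) < e / 2.
    by rewrite -px0 scale0r rnorm0 divr_gt0.
  apply: bnearS (bnearI (bnearI hM (bnear_base _ hp)) (bnear_norm hw)).
  move=> y w [[fM pM] we].
  rewrite -px0 mul0r add0r [e]splitr (le_lt_trans (rnormB_le _ _))// ltrD//.
  rewrite rnormZ rnormr ger0_norm// (le_lt_trans (ler_wpM2l (p0 y) fM))//.
  by rewrite -ltr_pdivlMr.
have c0 : 0 < e / 2 / p x by rewrite !divr_gt0.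
have /bnearZ[A [Q1 [Ac Q1v h]]] : bnear ((p x)%:C^-1 *: ((p x)%:C *: f x))
    (fun y w => rnorm (f y - w) < a + e / 2 / p x).
  by rewrite scalerA mulVf ?scale1r ?fmorph_eq0 ?gt_eqF//; exact: fa.
have hA : \forall y \near x, A ((p y)^-1%:C).
  have pV : (fun y => (p y)^-1) @ x --> (p x)^-1.
    by apply: cvgV => //; rewrite gt_eqF.
  by move: Ac; rewrite -fmorphV => /(cvg_real_complex pV).
have hp : \forall y \near x, p y * (a + e / 2 / p x) < p x * a + e /\ 0 < p y.
  apply: filterI; last exact: (cvgr_gt (p x) pc).
  have pM : (fun y => p y * (a + e / 2 / p x)) @ x -->
      p x * (a + e / 2 / p x) by apply: cvgMl.
  apply: (cvgr_lt _ pM); rewrite mulrDr ltrD2l mulrC divfK ?gt_eqF//.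
  by rewrite ltr_pdivrMr// ltr_pMr// ltr1n.
apply: bnearS (bnearI (bnear_base _ (filterI hA hp)) Q1v).
move=> y w [[Ay [py py0]] Qw]; apply: le_lt_trans py.
have -> : (p y)%:C *: f y - w = (p y)%:C *: (f y - (p y)^-1%:C *: w).
  rewrite scalerBr scalerA -rmorphM mulfV ?gt_eqF//= scale1r//.
by rewrite rnormZ rnormr gtr0_norm// ler_wpM2l ?(ltW py0)// ltW// h.
Qed.

Lemma osc_le_sum (I : Type) (r : seq I) (f : I -> forall y, fiber E y)
    (a : I -> R) x : (forall i, osc_le (f i) (a i) x) ->
  osc_le (fun y => \sum_(i <- r) f i y) (\sum_(i <- r) a i) x.
Proof.
move=> fa; elim: r => [|i r ih].
  rewrite big_nil (_ : (fun y => _) = fun y => 0); last first.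
    by apply: functional_extensionality_dep => y; rewrite big_nil.
  rewrite -(mulr0 2); apply: osc_le_bounded => y.
  by rewrite rnorm0.
rewrite big_cons (_ : (fun y => _) = fun y => f i y + \sum_(j <- r) f j y).
  exact: osc_leD.
by apply: functional_extensionality_dep => y; rewrite big_cons.
Qed.

(** Openness of [bproj] yields a vector [w] near [f x] that is close to [f y], and [f y] is [w] plus
    a small vector. *)
Lemma osc_le_scvg f x : (forall e, 0 < e -> osc_le f e x) ->
  scvg (nbhs x) f (f x).
Proof.
move=> fx; apply: bnear_scvg => Q; rewrite -[f x]addr0 => /bnearD[Q1 [Q2 [h1]]].
rewrite ?addr0 => /bnear0[e e0 h2] h.
have e2 : 0 < e / 2 by rewrite divr_gt0.
have := bnear_open (bnearI (fx _ e2 _ e2) h1).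
apply: filterS2 h2 => y h2 [w [fw Q1w]].
by rewrite -[f y](subrKC w); apply: h => //; apply: h2; rewrite [e]splitr.
Qed.

End oscillation.

Lemma geometric_lt {R : realType} (c e : R) : 0 < e -> exists n, c / 2 ^+ n < e.
Proof.
move=> e0; have := @cvg_geometric R c (2^-1).
rewrite ger0_norm// invf_lt1// ltr1n => /(_ isT) h.
have [n _ /(_ n (leqnn n))] := cvgr_lt _ h _ e0.
by rewrite /= exprVn; exists n.
Qed.

Lemma geometric_cvg {R : realType} {V : completeNormedModType R[i]}
    (u : nat -> V) (B : R) :
  (forall n, rnorm (u n.+1 - u n) <= B / 2 ^+ n) ->
  exists l, forall n, rnorm (l - u n) <= 2 * B / 2 ^+ n.
Proof.
move=> uB.
have B0 : 0 <= B by have := uB 0; rewrite expr0 divr1; apply: le_trans (rnorm_ge0 _).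
have h n m : rnorm (u (n + m)%N - u n) <= 2 * B / 2 ^+ n - 2 * B / 2 ^+ (n + m).
  elim: m => [|m ih]; first by rewrite addn0 !subrr rnorm0.
  rewrite addnS -(subrKA (u (n + m)%N)) (le_trans (rnormD _ _))//.
  rewrite (le_trans (lerD (uB _) ih))//.
  by rewrite exprS invfM; lra.
have h' n m : (n <= m)%N -> rnorm (u m - u n) <= 2 * B / 2 ^+ n.
  move=> nm; rewrite -(subnKC nm) (le_trans (h _ _))// gerBl divr_ge0 ?mulr_ge0//.
have cu : cvg (u @ \oo).
  apply: cauchy_cvg; apply: cauchy_exP => e e0.
  have er : e = (complex.Re e)%:C by rewrite RRe_real// gtr0_real.
  move: e0; rewrite er ltcR => e0.
  have [n hn] := geometric_lt (2 * B) e0.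
  exists (u n); exists n => // m /= nm.
  rewrite -ball_normE /= -rnormE ltcR rdistC.
  by apply: le_lt_trans (h' _ _ nm) hn.
exists (lim (u @ \oo)) => n; apply/ler_addgt0Pr => e e0.
near \oo => m.
have nm : (n <= m)%N by near: m; exact: nbhs_infty_ge.
have um : rnorm (lim (u @ \oo) - u m) < e.
  by rewrite rdistC; near: m; exact: (cvg_rnormP u _).1 cu e e0.
rewrite -(subrKA (u m)) (le_trans (rnormD _ _))// addrC.
by rewrite lerD ?h'// ltW.
Unshelve. all: by end_near. Qed.
(** * Extension of sections from closed sets *)

Section partition_of_unity.
Context {R : realType} {X : topologicalType}.
Hypotheses (cX : compact [set: X]) (hX : hausdorff_space X).

(** A Urysohn function equal to 1 at [i] and vanishing off the interior of [U i] is positive near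
    [i]; by compactness finitely many have a positive sum, by which all are divided. *)
Lemma partition_of_unity (U : X -> set X) : (forall x, nbhs x (U x)) ->
  exists (s : seq X) (p : X -> X -> R), [/\ forall i, continuous (p i),
    forall i y, 0 <= p i y, forall y, \sum_(i <- s) p i y = 1 &
    forall i y, 0 < p i y -> U i y].
Proof.
move=> Ux.
have nX := compact_normal hX cX.
have cl1 (x : X) : closed [set x].
  by apply: accessible_closed_set1; exact: hausdorff_accessible.
have /choice[q qP] : forall i, exists q : X -> R, [/\ continuous q,
    forall y, 0 <= q y, q i = 1 & forall y, 0 < q y -> U i y].
  move=> i; have clU : closed (~` (U i)°).
    by apply: open_closedC; exact: open_interior.
  have [|q [cq q0 q1 qr]] := urysohn_ext_itv nX clU (cl1 i) _ (@ltr01 R).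
    by rewrite -subset0 => y [/= h yi]; apply: h; rewrite yi; exact: Ux.
  exists q; split => //.
  - by move=> y; have /(_ (q y)) := qr; rewrite /= in_itv/= => /(_ _)/andP[]//; exists y.
  - by apply: q1; exists i.
  move=> y qy; apply: contrapT => nU; move: qy.
  have -> : q y = 0 by apply: q0; exists y => // /interior_subset.
  by rewrite ltxx.
have [s sP] : exists s : seq X, forall y, exists2 i, i \in s & 0 < q i y.
  (* Compactness is used in its near-covering form, along the filter of finite lists ordered by
     inclusion: eventually a list indexes a cover. *)
  pose F := filter_from setT (fun s : seq X => [set s' : seq X | {subset s <= s'}]).
  have FF : ProperFilter F.
    apply: filter_from_proper; last by move=> s _; exists s.
    apply: filter_from_filter; first by exists [::].
    move=> s1 s2 _ _; exists (s1 ++ s2) => // s h.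
    by split=> z zs; apply: h; rewrite mem_cat zs ?orbT.
  have h : \forall s \near F, [set: X] `<=`
      [set y | exists2 i, i \in s & 0 < q i y].
    apply: ((compact_near_coveringP _).1 cX) => x _.
    exists ([set y | 0 < q x y], [set s : seq X | x \in s]) => /=.
      split; last by exists [:: x] => // s /(_ x); rewrite mem_head; apply.
      have [cq _ q1 _] := qP x.
      by apply: (cvgr_gt _ (cq x)); rewrite q1.
    by move=> [y s] /= [qy sx]; exists x.
  by have [s sP] := @filter_ex _ F FF _ h; exists s => y; apply: sP.
pose Q y := \sum_(i <- s) q i y.
have Q0 y : 0 < Q y.
  have [i si qi] := sP y.
  rewrite /Q (big_rem i)//= ltr_pwDl// sumr_ge0// => j _.
  by have [_ /(_ y)] := qP j.
have cQ : continuous Q.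
  move=> y; rewrite /Q; apply: (@cvg_sum R R^o) => i.
  by have [h _ _ _] := qP i; exact: h.
exists s, (fun i y => q i y / Q y); split.
- move=> i y; apply: cvgM; first by have [h _ _ _] := qP i; exact: h.
  by apply: cvgV; [rewrite gt_eqF|exact: cQ].
- by move=> i y; have [_ q0 _ _] := qP i; exact: divr_ge0 (q0 y) (ltW (Q0 y)).
- by move=> y; rewrite -mulr_suml -/(Q y) mulfV// gt_eqF// Q0.
move=> i y h; have [_ _ _] := qP i; apply.
by move: h; rewrite pmulr_lgt0// invr_gt0.
Qed.

End partition_of_unity.

Section extension.
Context {R : realType} {X : topologicalType} (E : banach_bundle R X).
Hypotheses (cX : compact [set: X]) (hX : hausdorff_space X).
Variables (K : set X).
Hypothesis clK : closed K.
Implicit Types (f g : forall y, fiber E y).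

Let cts_on f := forall x, K x -> scvg (within K (nbhs x)) f (f x).

(* Near [x] any selection inside a thin open tube around [f x] has small
   oscillation. *)
Lemma osc_improve_local f (a b : R) x : 0 < a -> 0 < b -> cts_on f ->
  osc_le f a x -> exists U g, [/\ nbhs x U, forall y, K y -> g y = f y,
    forall y, rnorm (g y - f y) <= 2 * a & forall y, U y -> osc_le g b y].
Proof.
move=> a0 b0 cf fa.
have [T vT hT] := bnear_tube (f x) b0.
pose Q y (w : fiber E y) := rnorm (f y - w) < a + a /\ T y w.
pose P y (w : fiber E y) := bnear w Q.
have vP : bnear (f x) P by apply: bnear_interior; apply: bnearI => //; exact: fa.
(* The section [g] keeps the value of [f] on [K]; elsewhere it picks a vector of [P] if the fibre
   has one and falls back on [f] otherwise. *)
have gP y : exists w : fiber E y, rnorm (w - f y) <= 2 * a /\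
    ((exists w, P y w) -> (K y -> P y (f y)) -> P y w) /\ (K y -> w = f y).
  have a2 : rnorm (f y - f y) <= 2 * a.
    by rewrite subrr rnorm0 mulr_ge0// ltW.
  have [Ky|nKy] := pselect (K y).
    by exists (f y); split => //; split => // _; apply.
  have [[w Pw]|nP] := pselect (exists w, P y w); last first.
    by exists (f y); split => //; split.
  exists w; split => //.
  have [/ltW + _] := bnear_self Pw.
  by rewrite rdistC => /le_trans; apply; rewrite mulr2n mulrDl mul1r.
pose g y := sval (cid (gP y)).
have gE y := svalP (cid (gP y)).
(* On [U] the section [g] lands in [P]. The first condition holds near [x] by openness of [bproj],
   the second by continuity of [f] along [K] if [x] is in [K], and by closedness of [K]
   otherwise. *)
pose U y := (exists w, P y w) /\ (K y -> P y (f y)).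
have xU : nbhs x U.
  apply: filterI; first exact: bnear_open vP.
  have [Kx|nKx] := pselect (K x).
    exact: (scvg_bnear (cf x Kx) vP).
  have : nbhs x (~` K) by apply: open_nbhs_nbhs; split => //; exact: closed_openC.
  by apply: filterS => y nKy /nKy.
exists (interior U), g; split.
- exact: nbhs_interior.
- by move=> y Ky; have [_ [_]] := gE y; apply.
- by move=> y; have [] := gE y.
move=> y yU.
have gPP z : U z -> P z (g z) by move=> [z1 z2]; have [_ [h _]] := gE z; exact: h.
have Py := gPP _ (nbhs_singleton yU).
move=> e e0; apply: bnearS (bnearI Py (bnear_base _ yU)) => z w [[_ Tw] Uz].
have [_ Tg] := bnear_self (gPP _ Uz).
by rewrite (lt_le_trans (hT _ _ _ Tg Tw))// lerDl ltW.
Qed.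

(** Local improvements are averaged with a partition of unity; convex combinations preserve the
    values on [K], the distance to [f] and the bound [b] on the oscillation. *)
Lemma osc_improve f (a b M : R) : 0 < a -> 0 < b -> cts_on f ->
  (forall y, rnorm (f y) <= M) -> (forall x, osc_le f a x) ->
  exists g, [/\ forall y, K y -> g y = f y,
    forall y, rnorm (g y - f y) <= 2 * a & forall x, osc_le g b x].
Proof.
move=> a0 b0 cf fM fa.
have UGex (x : X) : exists UG : set X * (forall y, fiber E y),
    [/\ nbhs x UG.1, forall y, K y -> UG.2 y = f y,
    forall y, rnorm (UG.2 y - f y) <= 2 * a & forall y, UG.1 y -> osc_le UG.2 b y].
  have [U [g [? ? ? ?]]] := osc_improve_local a0 b0 cf (fa x).
  by exists (U, g).
pose UG x := sval (cid (UGex x)); have UGP x := svalP (cid (UGex x)).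
have [|s [p [cp p0 p1 pU]]] := @partition_of_unity R X cX hX (fun x => (UG x).1).
  by move=> x; have [] := UGP x.
have sumf y (w : fiber E y) : \sum_(i <- s) (p i y)%:C *: w = w.
  by rewrite -scaler_suml -rmorph_sum p1 scale1r.
exists (fun y => \sum_(i <- s) (p i y)%:C *: (UG i).2 y); split.
- move=> y Ky; rewrite -[RHS]sumf; apply: eq_bigr => i _; congr (_ *: _).
  by have [_ /(_ y Ky)] := UGP i.
- move=> y; have -> : \sum_(i <- s) (p i y)%:C *: (UG i).2 y - f y =
      \sum_(i <- s) (p i y)%:C *: ((UG i).2 y - f y).
    by under [RHS]eq_bigr do rewrite scalerBr; rewrite sumrB sumf.
  rewrite (le_trans (rnorm_sum_le _ _ _))//.
  apply: (@le_trans _ _ (\sum_(i <- s) p i y * (2 * a))); last first.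
    by rewrite -mulr_suml p1 mul1r.
  apply: ler_sum => i _.
  rewrite rnormZ rnormr ger0_norm// ler_wpM2l//.
  by have [_ _ h _] := UGP i; exact: h.
move=> x; apply: (@osc_le_trans _ _ _ _ (\sum_(i <- s) p i x * b)).
  by rewrite -mulr_suml p1 mul1r.
apply: osc_le_sum => i.
have [px|px] := ltP 0 (p i x).
  apply: (osc_leZ (cp i x) (p0 i x) (p0 i) _ (ltW b0)).
  by have [_ _ _ h] := UGP i; apply/h/pU.
(* At a zero of [p i] the [i]-th improvement may oscillate widely, but it is bounded, so its product
   with [p i] has oscillation 0 there. *)
have {}px : p i x = 0 by apply/eqP; rewrite eq_le px p0.
have bd y : rnorm ((UG i).2 y) <= M + 2 * a.
  rewrite -[(UG i).2 y](subrK (f y)) addrC (le_trans (rnormD _ _))// lerD//.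
  by have [_ _ h _] := UGP i; exact: h.
rewrite px mul0r -(mul0r (2 * (M + 2 * a))) -{1}px.
apply: (osc_leZ (cp i x) (p0 i x) (p0 i) (osc_le_bounded x bd)).
by rewrite mulr_ge0// (le_trans (rnorm_ge0 _) (bd x)).
Qed.

(** The extension by 0 has oscillation at most [2 * M]. Halving the oscillation repeatedly changes
    the section by summable amounts, so the limit is uniform and has oscillation 0. *)
Lemma csection_extension (t : forall y, fiber E y) (M : R) : 0 <= M ->
  cts_on t -> (forall y, K y -> rnorm (t y) <= M) ->
  exists s : csection E, forall y, K y -> s y = t y.
Proof.
move=> M0 ct tM; pose A := 2 * M + 1.
have A0 : 0 < A by rewrite ltr_wpDl ?mulr_ge0.
have cts_eq f : (forall y, K y -> f y = t y) -> cts_on f.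
  move=> ft x Kx; rewrite ft//; apply: scvg_near (ct x Kx).
  by apply: filterS (withinT _ _) => y Ky; rewrite ft.
pose good n f := [/\ forall y, K y -> f y = t y,
  exists M, forall y, rnorm (f y) <= M & forall x, osc_le f (A / 2 ^+ n) x].
have Stex : forall nf : nat * (forall y, fiber E y), exists g,
    good nf.1 nf.2 -> good nf.1.+1 g /\
      forall y, rnorm (g y - nf.2 y) <= 2 * A / 2 ^+ nf.1.
  move=> [n f]; have [|ng] := pselect (good n f); last by exists f.
  move=> [/= ft [B fB] fo].
  have A1 m : 0 < A / 2 ^+ m by rewrite divr_gt0// exprn_gt0.
  have [g [gf gfa go]] := osc_improve (A1 n) (A1 n.+1) (cts_eq _ ft) fB fo.
  exists g => _; split; last by move=> y; rewrite -mulrA.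
  split => //; first by move=> y Ky; rewrite gf// ft.
  exists (B + 2 * (A / 2 ^+ n)) => y.
  by rewrite -[g y](subrK (f y)) addrC (le_trans (rnormD _ _))// lerD.
pose St nf := sval (cid (Stex nf)); have StP nf := svalP (cid (Stex nf)).
pose f0 y : fiber E y := if `[< K y >] then t y else 0.
pose F := fix F n := if n is m.+1 then St (m, F m) else f0.
have Fgood n : good n (F n).
  elim: n => [|n ih]; last by have [] := StP (n, F n) ih.
  have f0M y : rnorm (f0 y) <= M.
    by rewrite /f0; case: asboolP => [/tM//|_]; rewrite rnorm0.
  split; [by move=> y Ky; rewrite /= /f0 asboolT|by exists M|].
  move=> x; rewrite expr0 divr1; apply: osc_le_trans (osc_le_bounded x f0M).
  by rewrite lerDl.
have Fstep n y : rnorm (F n.+1 y - F n y) <= 2 * A / 2 ^+ n.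
  by have [_] := StP (n, F n) (Fgood n); apply.
have lP y := geometric_cvg (fun n => Fstep n y).
pose l y := sval (cid (lP y)).
have lE y := svalP (cid (lP y)).
have lc x : scvg (nbhs x) l (l x).
  apply: osc_le_scvg => e e0; have [n ne] := geometric_lt (9 * A) e0.
  have -> : l = (fun y => F n y + (l y - F n y)).
    by apply: functional_extensionality_dep => y; rewrite subrKC.
  apply: osc_le_trans (ltW ne) _.
  (* The oscillation of [F n], plus twice the bound [4 * A / 2 ^+ n] on its distance to [l]. *)
  have -> : 9 * A / 2 ^+ n = A / 2 ^+ n + 2 * (2 * (2 * A) / 2 ^+ n) by lra.
  apply: osc_leD; first by have [_ _] := Fgood n.
  exact: osc_le_bounded.
exists (CSection lc) => y Ky /=; apply/eqP; rewrite -subr_eq0 -[_ == 0]negbK -rnorm_gt0.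
apply/negP => ly; have [n] := geometric_lt (2 * (2 * A)) ly; apply/negP; rewrite -leNgt.
by have [/(_ y Ky) <- _ _] := Fgood n.
Qed.

End extension.
(** * Dimension and frames *)

Section lower_bound.
Context {R : realType}.

Lemma mx_entry_le_norm (m n : nat) (a : 'M[R]_(m, n)) i j : `|a i j| <= `|a|.
Proof.
rewrite [leRHS]/Num.norm /= mx_normrE.
exact: (le_bigmax _ (fun ij : 'I_m * 'I_n => `|a ij.1 ij.2|) (i, j)).
Qed.

(** The unit sphere is compact, and the Lipschitz bound spreads each pointwise lower bound to nearby
    vectors; homogeneity then reaches all vectors. *)
Lemma uniform_lower_bound {T : Type} {F : set_system T} {FF : Filter F}
    (n : nat) (p : T -> 'rV[R]_n -> R) (L : R) :
  (\forall t \near F, forall a b, `|p t a - p t b| <= L * `|a - b|) ->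
  (forall a, a != 0 -> exists2 d : R, 0 < d & \forall t \near F, d <= p t a) ->
  (forall t (r : R) a, 0 <= r -> p t (r *: a) = r * p t a) ->
  exists2 c : R, 0 < c & \forall t \near F, forall a, c * `|a| <= p t a.
Proof.
move=> pL pd pZ.
pose K := [set a : 'rV[R]_n | `|a| = 1].
have cK : compact K.
  apply: bounded_closed_compact.
    by exists 1; split => // M M1 a /= ->; exact: ltW.
  apply: (@closed_comp _ _ (fun a : 'rV[R]_n => `|a|) [set 1]).
    by move=> a _; exact: norm_continuous.
  exact: closed_eq.
(* The parameter of the covering argument pairs a candidate constant tending to 0 from the right
   with a point along [F], so that one constant serves the whole sphere. *)
have : \forall ct \near filter_prod (at_right (0 : R)) F,
    K `<=` (fun a => ct.1 <= p ct.2 a).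
  apply: ((compact_near_coveringP _).1 cK) => a aK.
  have a0 : a != 0 by rewrite -normr_gt0 aK.
  have [d d0 hd] := pd a a0.
  have L0 : 0 < `|L| + 1 by rewrite ltr_wpDl.
  have r0 : 0 < d / 2 / (`|L| + 1) by rewrite !divr_gt0.
  exists (ball a (d / 2 / (`|L| + 1)),
     [set ct | ct.1 <= d / 2 /\ (d <= p ct.2 a /\
        forall a b, `|p ct.2 a - p ct.2 b| <= L * `|a - b|)]) => /=.
    split; first exact: nbhsx_ballx.
    exists ([set c | c <= d / 2], [set t | d <= p t a /\
        forall a b, `|p t a - p t b| <= L * `|a - b|]) => /=.
      split; last exact: filterI.
      by apply: nbhs_right_le; rewrite divr_gt0.
    by move=> [c t] /= [].
  move=> [b [c t]] /=; rewrite -ball_normE /= => -[ab [cd [da pt]]].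
  apply: (le_trans cd); have := pt a b; rewrite ler_norml => /andP[_].
  have : L * `|a - b| <= d / 2.
    rewrite (@le_trans _ _ ((`|L| + 1) * `|a - b|))//.
      by rewrite ler_wpM2r// (le_trans (ler_norm L))// lerDl.
    by rewrite mulrC -ler_pdivlMr// ltW.
  lra.
move=> [[A B] /= [A0 FB] AB].
have [c [Ac c0]] : exists c, A c /\ 0 < c.
  exact: (filter_ex (filterI A0 (nbhs_right_gt 0))).
exists c => //; apply: filterS FB => t Bt a.
have [->|a0] := eqVneq a 0.
  by rewrite normr0 mulr0 -(scale0r (0 : 'rV[R]_n)) pZ// mul0r.
have an : 0 < `|a| by rewrite normr_gt0.
have := AB (c, t) (conj Ac Bt) (`|a|^-1 *: a).
rewrite pZ ?invr_ge0// ler_pdivlMl// mulrC; apply.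
by rewrite /K /= normrZ normfV normr_id mulVf ?normr_eq0.
Qed.

Definition lin_indep {V : lmodType R[i]} {d : nat} (v : 'I_d -> V) : Prop :=
  forall c : 'rV[R[i]]_d, \sum_(i < d) c 0 i *: v i = 0 -> c = 0.

Context {X : topologicalType} {E : banach_bundle R X}.

(** Continuity of the norm keeps each combination with fixed nonzero coefficients away from 0;
    [uniform_lower_bound] makes this uniform in the coefficients. *)
Lemma sections_lower_bound {F : set_system X} {FF : Filter F} (d : nat)
    (g : 'I_d -> forall y, fiber E y) x (v : 'I_d -> fiber E x) :
  is_F_bundle E -> F `=>` nbhs x -> (forall i, scvg F (g i) (v i)) ->
  lin_indep v ->
  exists2 k : R, 0 < k & \forall y \near F, forall (c : 'rV[R[i]]_d) i,
    k * rnorm (c 0 i : R[i]^o) <= rnorm (\sum_(i < d) c 0 i *: g i y).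
Proof.
move=> EF Fx gv vfree.
(* The [d] complex coefficients are encoded as [d + d] real ones, so that the compactness argument
   runs over [R]. *)
pose z (a : 'rV[R]_(d + d)) (i : 'I_d) : R[i] :=
  (a 0 (lshift d i)) +i* (a 0 (rshift d i)).
pose p y a := rnorm (\sum_(i < d) z a i *: g i y).
have zB a b i : z a i - z b i = z (a - b) i.
  by rewrite /z !mxE; apply/eqP; rewrite eq_complex /= !eqxx.
have zZ (r : R) a i : z (r *: a) i = r%:C * z a i.
  by rewrite /z !mxE; apply/eqP; rewrite eq_complex /= !mul0r addr0 subr0 !eqxx.
have z_le a i : rnorm (z a i : R[i]^o) <= 2 * `|a|.
  rewrite (le_trans (rnorm_le_ReIm _))//= mulr2n mulrDl mul1r.
  by rewrite lerD// mx_entry_le_norm.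
pose L := \sum_(i < d) 2 * (rnorm (v i) + 1).
have [|||c c0 hc] := @uniform_lower_bound X F FF (d + d) p L.
- have : \forall y \near F, forall i, rnorm (g i y) < rnorm (v i) + 1.
    apply: filter_forall => i.
    by apply: (scvg_usc (gv i)); rewrite ltrDl.
  apply: filterS => y gy a b.
  rewrite (le_trans (rnorm_dist_le _ _))// -sumrB mulr_suml.
  rewrite (le_trans (rnorm_sum_le _ _ _))//; apply: ler_sum => i _.
  rewrite -scalerBl zB rnormZ mulrAC ler_pM ?rnorm_ge0//.
  exact: ltW.
- move=> a a0.
  pose w := \sum_(i < d) z a i *: v i.
  have w0 : 0 < rnorm w.
    rewrite rnorm_gt0; apply: contra_neq a0 => w0.
    have /vfree : \sum_(i < d) (\row_i z a i) 0 i *: v i = 0.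
      by rewrite -[RHS]w0; apply: eq_bigr => i _; rewrite mxE.
    move=> /rowP za; apply/rowP => j; rewrite mxE.
    case: (split_ordP j) => i ->; have := za i; rewrite !mxE.
      by move=> /(congr1 (@complex.Re R)).
    by move=> /(congr1 (@complex.Im R)).
  have : scvg F (fun y => \sum_(i < d) z a i *: g i y) w.
    apply: scvg_sum => // i; apply: scvgZ => //; exact: cvg_cst.
  move=> /(scvg_norm EF) pw.
  exists (rnorm w / 2); first by rewrite divr_gt0.
  apply: (cvgr_ge _ pw).
  by rewrite ltr_pdivrMr// ltr_pMr// ltr1n.
- move=> y r a r0; rewrite /p.
  under eq_bigr do rewrite zZ -scalerA.
  by rewrite -scaler_sumr rnormZ rnormr ger0_norm.
exists (c / 2); first by rewrite divr_gt0.
apply: filterS hc => y hc s i.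
pose a : 'rV[R]_(d + d) := row_mx (\row_j complex.Re (s 0 j)) (\row_j complex.Im (s 0 j)).
have za j : z a j = s 0 j.
  by rewrite /z row_mxEl row_mxEr !mxE; case: (s 0 j).
have := hc a; rewrite /p; under eq_bigr do rewrite za.
apply: le_trans; rewrite -mulrA ler_pM2l// ler_pdivrMl//.
by rewrite -za.
Qed.

End lower_bound.

Lemma at_fiber_inj {R : realType} {X : topologicalType} (E : bundle_data R X)
  (x : X) : injective (@at_fiber R X E x).
Proof.
move=> v w /(can_inj (@bpointK _ _ E)) vw.
have tE (u : fiber E x) :
    tagged_as (existT (fiber E) x v) (existT (fiber E) x u) = u.
  by rewrite -[existT _ x u]/(Tagged (fiber E)
    (u : fiber E (tag (existT (fiber E) x v)))) tagged_asE.
by rewrite -(tE v) {2}vw tE.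
Qed.

Lemma at_fiberP {R : realType} {X : topologicalType} (E : bundle_data R X)
  (e : bspace E) (x : X) : bproj e = x -> exists v : fiber E x, e = at_fiber v.
Proof.
move=> <-; exists (tagged (bcoord e)).
by rewrite at_fiber_bcoord.
Qed.

Lemma has_dim_dependent (K : fieldType) (V : lmodType K) (m k : nat)
    (w : 'I_k -> V) : has_dim V m -> (m < k)%N ->
  exists2 c : 'rV[K]_k, c != 0 & \sum_(i < k) c 0 i *: w i = 0.
Proof.
move=> [b bP] mk.
have A_ i : exists a : 'rV[K]_m, w i = \sum_(j < m) a 0 j *: b j.
  by have [a []] := bP (w i); exists a.
pose A := \matrix_(i < k) sval (cid (A_ i)).
have wE i : w i = \sum_(j < m) A i j *: b j.
  by rewrite {1}(svalP (cid (A_ i))); apply: eq_bigr => j _; rewrite !mxE.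
have /rowV0Pn[c cA c0] : kermx A != 0.
  rewrite kermx_eq0 /row_free neq_ltn.
  by rewrite (leq_ltn_trans (rank_leq_col A) mk).
exists c => //; under eq_bigr do rewrite wE scaler_sumr.
rewrite exchange_big /= big1// => j _.
under eq_bigr do rewrite scalerA.
rewrite -scaler_suml.
have /matrixP/(_ 0 j) := sub_kermxP cA; rewrite !mxE => ->.
by rewrite scale0r.
Qed.

Section dimension_strata.
Context {R : realType} {X : topologicalType} (E : banach_bundle R X).
Hypotheses (cX : compact [set: X]) (hX : hausdorff_space X).
Hypotheses (E_F : is_F_bundle E).

(** A vector is a section over the closed set [{x}], and extends from there. Off [x], [tagged_as]
    returns the default 0. *)
Lemma csection_through (x : X) (v : fiber E x) : exists s : csection E, s x = v.
Proof.
pose t y : fiber E y :=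
  tagged_as (existT (fiber E) y 0) (existT (fiber E) x v).
have tx : t x = v.
  by rewrite /t -[existT _ x v]/(Tagged (fiber E)
    (v : fiber E (tag (existT (fiber E) x 0)))) tagged_asE.
have cl1 : closed [set x].
  by apply: accessible_closed_set1; exact: hausdorff_accessible.
have [||y -> {y}|s st] := csection_extension cX hX cl1 (t := t) (M := rnorm v).
- exact: rnorm_ge0.
- move=> _ ->; apply: bnear_scvg => Q /bnear_self Qt.
  by apply: filterS (withinT _ _) => y /= ->.
- by rewrite tx.
by exists s; rewrite st.
Qed.

Definition dim_lt_set (d : nat) : set X :=
  [set x | exists2 k, (k < d)%N & has_dim (fiber E x) k].

(** Sections through a basis of the fibre at [x] stay linearly independent nearby, so the dimension
    cannot drop near [x]. *)
Lemma closed_dim_lt_set d : subhomogeneous E -> closed (dim_lt_set d).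
Proof.
move=> [N EN]; rewrite -[dim_lt_set d]setCK; apply: open_closedC.
rewrite openE => x nx; have [k _ [b bP]] := EN x.
have dk : (d <= k)%N.
  by rewrite leqNgt; apply/negP => kd; apply: nx; exists k => //; exists b.
have sP i := csection_through (b i).
pose s i := sval (cid (sP i)).
have sx i : s i x = b i := svalP (cid (sP i)).
have [|i|c cb|r r0] := @sections_lower_bound R X E (nbhs x) _ k s x b E_F.
- by [].
- by rewrite -sx; exact: section_cts.
- have [a [_ aU]] := bP 0.
  have <- := aU c (esym cb); apply: aU.
  by rewrite big1// => i _; rewrite mxE scale0r.
apply: filterS => y ry [m md ym].
have [c c0 cs] := has_dim_dependent (s^~ y) ym (leq_trans md dk).
move: c0 => /negP; apply; apply/eqP/rowP => i; rewrite mxE.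
have := ry c i; rewrite cs rnorm0 pmulr_rle0// => ci.
by apply: (@rnorm_eq0 R R[i]^o); apply/eqP; rewrite eq_le ci rnorm_ge0.
Qed.

End dimension_strata.

(* The fibres over [W] have the basis [e], with dual basis [l]. *)
Definition dual_frames {R : realType} {X : topologicalType}
  (E : banach_bundle R X) (W : set X) (d : nat)
  (e : 'I_d -> forall y, fiber E y) (l : 'I_d -> forall y, fiber E y -> R[i]^o) :=
  [/\ forall i y c v w, W y -> l i y (c *: v + w) = c * l i y v + l i y w,
    forall y v, W y -> (forall i, l i y v = 0) -> v = 0,
    forall i j y, W y -> l i y (e j y) = (i == j)%:R,
    forall j x, W x -> scvg (within W (nbhs x)) (e j) (e j x) &
    forall x, W x -> exists M : R,
      \forall y \near within W (nbhs x), forall v i, rnorm (l i y v) <= M * rnorm v].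

Lemma dual_framesS {R : realType} {X : topologicalType} (E : banach_bundle R X)
    (W W' : set X) d (e : 'I_d -> forall y, fiber E y) l :
  W' `<=` W -> dual_frames W e l -> dual_frames W' e l.
Proof.
move=> WW' [h1 h2 h3 h4 h5].
have sub (x : X) : within W' (nbhs x) `=>` within W (nbhs x).
  move=> A h; have {}h : \forall y \near x, W y -> A y := h.
  suff : \forall y \near x, W' y -> A y by [].
  by apply: filterS h => y Wy /WW'.
split.
- by move=> i y c v w /WW'; exact: h1.
- by move=> y v /WW'; exact: h2.
- by move=> i j y /WW'; exact: h3.
- by move=> j x W'x; apply: (scvg_sub (sub x) (h4 j x (WW' _ W'x))).
by move=> x /WW' /h5[M hM]; exists M; exact: (sub x _ hM).
Qed.

Lemma linear_comb (K : nzRingType) (V W : lmodType K) (f : V -> W) (I : Type)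
    (r : seq I) (c : I -> K) (v : I -> V) :
  (forall a u w, f (a *: u + w) = a *: f u + f w) ->
  f (\sum_(i <- r) c i *: v i) = \sum_(i <- r) c i *: f (v i).
Proof.
move=> fl; have f0 : f 0 = 0.
  by have /(congr1 (fun u => u - f 0)) := fl 1 0 0; rewrite !scale1r addr0 subrr addrK.
elim: r => [|i r ih]; first by rewrite !big_nil.
by rewrite !big_cons fl ih.
Qed.

(** A basis of one fibre gives a basis [b] of [E0]; [e j] is the vector [Psi (y, b j)], and [l]
    reads coordinates in [b]. The local bound on [l] inverts the lower bound of
    [sections_lower_bound]. *)
Lemma trivial_dual_frames {R : realType} {X : topologicalType}
    (E : banach_bundle R X) (U : set X) (d : nat) : is_F_bundle E ->
  U `<=` dim_eq_set E d -> trivial_over E U ->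
  exists (e : 'I_d -> forall y, fiber E y) (l : 'I_d -> forall y, fiber E y -> R[i]^o),
    dual_frames U e l.
Proof.
move=> EF Ud [E0 [Phi [Psi [[_ cPsi] PsiK PhiK Phi1 Philin]]]].
(* For empty [U] there is no fibre to give [E0] a basis, but all the conditions are void. *)
have [[x0 Ux0]|U0] := pselect (exists x, U x); last first.
  exists (fun j y => 0), (fun i y v => 0); split.
  - by move=> i y c v w Uy; case: U0; exists y.
  - by move=> y v Uy; case: U0; exists y.
  - by move=> i j y Uy; case: U0; exists y.
  - by move=> i y Uy; case: U0; exists y.
  - by move=> y Uy; case: U0; exists y.
have [bt btP] := Ud _ Ux0.
pose ph y (v : fiber E y) := (Phi (at_fiber v)).2.
have phlin y : U y -> forall a (u w : fiber E y), ph y (a *: u + w) = a *: ph y u + ph y w.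
  by move=> Uy a u w; exact: Philin.
have phE y (v : fiber E y) : U y -> Psi (y, ph y v) = at_fiber v.
  move=> Uy; rewrite -[RHS]PsiK ?bproj_at//; congr Psi.
  by rewrite [RHS]surjective_pairing Phi1 bproj_at.
have phI y (v w : fiber E y) : U y -> ph y v = ph y w -> v = w.
  by move=> Uy vw; apply: at_fiber_inj; rewrite -!phE// vw.
have phS y u : U y -> exists v : fiber E y, Psi (y, u) = at_fiber v /\ ph y v = u.
  move=> Uy; have [Ue Pe] := PhiK (y, u) Uy.
  have [v ev] : exists v : fiber E y, Psi (y, u) = at_fiber v.
    by apply: at_fiberP; rewrite -Phi1// Pe.
  by exists v; split => //; rewrite /ph -ev Pe.
pose b j := ph x0 (bt j).
have phb (c : 'rV_d) : ph x0 (\sum_(i < d) c 0 i *: bt i) = \sum_(i < d) c 0 i *: b i.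
  by apply: linear_comb; exact: phlin.
have kex u : exists c : 'rV[R[i]]_d, u = \sum_(i < d) c 0 i *: b i.
  have [v [_ <-]] := phS x0 u Ux0; have [c [cv _]] := btP v.
  by exists c; rewrite [in LHS]cv phb.
pose k u := sval (cid (kex u)).
have kP u : u = \sum_(i < d) k u 0 i *: b i := svalP (cid (kex u)).
have kU u (c : 'rV_d) : u = \sum_(i < d) c 0 i *: b i -> k u = c.
  rewrite {1}(kP u) -!phb => /(phI _ _ _ Ux0) cc.
  have [a [_ aU]] := btP (\sum_(i < d) c 0 i *: bt i).
  by rewrite -(aU c erefl) -(aU (k u) (esym cc)).
pose l i y (v : fiber E y) : R[i]^o := k (ph y v) 0 i.
have eex j y : exists v : fiber E y, U y -> Psi (y, b j) = at_fiber v /\ ph y v = b j.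
  have [Uy|nUy] := pselect (U y); last by exists 0.
  by have [v vP] := phS y (b j) Uy; exists v.
pose e j y := sval (cid (eex j y)).
have eP j y : U y -> Psi (y, b j) = at_fiber (e j y) /\ ph y (e j y) = b j.
  exact: svalP (cid (eex j y)).
have l_lin i y c v w : U y -> l i y (c *: v + w) = c * l i y v + l i y w.
  move=> Uy; rewrite /l phlin// (kU _ (c *: k (ph y v) + k (ph y w))) ?mxE//.
  rewrite [in LHS](kP (ph y v)) [in LHS](kP (ph y w)) scaler_sumr -big_split/=.
  by apply: eq_bigr => j _; rewrite !mxE scalerDl scalerA.
have l_faith y v : U y -> (forall i, l i y v = 0) -> v = 0.
  move=> Uy lv; apply: (phI y) => //.
  have -> : ph y v = 0 by rewrite [LHS]kP big1// => i _; rewrite -/(l i y v) lv scale0r.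
  have := phlin y Uy (-1) 0 0; rewrite scaler0 addr0 scaleN1r => ->.
  by rewrite addNr.
have l_dual i j y : U y -> l i y (e j y) = (i == j)%:R.
  move=> Uy; rewrite /l (eP j y Uy).2 (kU _ (delta_mx 0 j)) ?mxE//.
  rewrite (bigD1 j)//= mxE !eqxx scale1r big1 ?addr0// => m mj.
  by rewrite mxE (negPf mj) andbF scale0r.
have lsum i y (c : 'rV[R[i]]_d) : U y -> l i y (\sum_(j < d) c 0 j *: e j y) = c 0 i.
  move=> Uy; rewrite (@linear_comb R[i] (fiber E y) R[i]^o (l i y)); last first.
    by move=> a u w; exact: l_lin.
  rewrite (bigD1 i)//= l_dual// eqxx [_ *: _]mulr1 big1 ?addr0// => j ji.
  by rewrite l_dual// eq_sym (negPf ji) scaler0.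
have e_cts j x : U x -> scvg (within U (nbhs x)) (e j) (e j x).
  move=> Ux A; rewrite -(eP j x Ux).1 => PA.
  have h := (subspace_continuousP _ _).1 cPsi (x, b j) Ux A PA.
  have xb : (fun y => (y, b j)) @ x --> (x, b j).
    by apply: cvg_pair; [exact: cvg_id|exact: cvg_cst].
  apply: (@filterS _ (nbhs x) (nbhs_filter x) _ _ _ (xb _ h)) => y /= hy Uy.
  by rewrite -(eP j y Uy).1; exact: hy.
exists e, l; split => // x Ux.
have [|i|c ce|r r0 hr] := @sections_lower_bound R X E (within U (nbhs x)) _ d e x (e^~ x) EF.
- by apply: cvg_within.
- exact: e_cts.
- apply/rowP => i; rewrite -(lsum i x c Ux) ce -(lsum i x 0 Ux).
  by rewrite big1// => j _; rewrite mxE scale0r.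
exists r^-1; apply: filterS2 hr (withinT _ _) => y hy Uy v i.
have vE : v = \sum_(j < d) (\row_j l j y v) 0 j *: e j y.
  apply/eqP; rewrite -subr_eq0; apply/eqP; apply: (l_faith y) => // m.
  by rewrite addrC -scaleN1r l_lin// lsum// mxE mulN1r addNr.
rewrite ler_pdivlMl// [in leRHS]vE; apply: le_trans (hy _ i).
by rewrite mxE.
Qed.
Lemma cvg_rnorm {R : realType} {V : normedModType R[i]} {T : Type}
    {F : set_system T} {FF : Filter F} (f : T -> V) (l : V) :
  f @ F --> l -> (fun t => rnorm (f t)) @ F --> rnorm l.
Proof.
move=> /cvg_rnormP fl; apply/cvgrPdist_lt => e /fl; apply: filterS => y.
by rewrite distrC; apply: le_lt_trans (rnorm_dist_le _ _).
Qed.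

Lemma cvg_conj {R : realType} {T : Type}
    {F : set_system T} {FF : Filter F} (f : T -> R[i]^o) (l : R[i]^o) :
  f @ F --> l -> (fun t => (f t)^*%C : R[i]^o) @ F --> (l^*%C : R[i]^o).
Proof.
move=> /cvg_rnormP fl; apply/cvg_rnormP => e /fl; apply: filterS => y.
by rewrite -rmorphB rnorm_conj.
Qed.

(** * Simultaneous factorization of a sequence of sections *)

Section factorization.
Context {R : realType} {X : topologicalType} (E : banach_bundle R X).
Hypotheses (cX : compact [set: X]) (hX : hausdorff_space X).
Hypotheses (E_F : is_F_bundle E).

(** A continuous section [s] through [g x] is compared with [f]: their difference is small at [x],
    hence nearby by upper semicontinuity, and [f] is close to [g]. *)
Lemma scvg_uniform_limit {F : set_system X} {FF : Filter F}
    (g : forall y, fiber E y) x : F `=>` nbhs x ->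
  (forall e : R, 0 < e -> exists f, [/\ scvg F f (f x),
     rnorm (f x - g x) < e & \forall y \near F, rnorm (g y - f y) < e]) ->
  scvg F g (g x).
Proof.
move=> Fx gf; have [s sx] := csection_through cX hX (g x).
have sg : scvg F s (g x).
  by rewrite -sx; exact: (scvg_sub Fx (@section_cts _ _ _ s x)).
apply: (scvg_dist sg) => e e0.
have e2 : 0 < e / 2 by rewrite divr_gt0.
have [f [ff fx gfe]] := gf _ e2.
have h0 : \forall y \near F, rnorm (f y - s y) < e / 2.
  exact: scvg_usc (scvgB ff sg) fx.
apply: filterS2 gfe h0 => y h1 h2.
rewrite -(subrKA (f y)) (le_lt_trans (rnormD _ _))// [e]splitr.
by rewrite ltrD.
Qed.

Variables (W : set X) (d : nat) (e : 'I_d -> forall y, fiber E y)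
  (l : 'I_d -> forall y, fiber E y -> R[i]^o).
Arguments l : clear implicits.
Hypothesis fr : dual_frames W e l.

Local Notation cts s := (forall x, W x -> scvg (within W (nbhs x)) s (s x)).

Lemma frame_coord0 i y : W y -> l i y 0 = 0.
Proof.
move=> Wy; have [ll _ _ _ _] := fr.
by have := ll i y (-1) 0 0 Wy; rewrite scaler0 addr0 mulN1r addNr.
Qed.

Lemma frame_coordZ i y c v : W y -> l i y (c *: v) = c * l i y v.
Proof.
move=> Wy; have [ll _ _ _ _] := fr.
by rewrite -[c *: v]addr0 ll// frame_coord0// addr0.
Qed.

Lemma frame_coordB i y v w : W y -> l i y (v - w) = l i y v - l i y w.
Proof.
move=> Wy; have [ll _ _ _ _] := fr.
by rewrite addrC -scaleN1r ll// mulN1r addrC.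
Qed.

Lemma frame_coord_sum i y (I : Type) (r : seq I) (c : I -> R[i]) v : W y ->
  l i y (\sum_(j <- r) c j *: v j) = \sum_(j <- r) c j * l i y (v j).
Proof.
move=> Wy; have [ll _ _ _ _] := fr.
by apply: (@linear_comb R[i] (fiber E y) R[i]^o) => a u w; exact: ll.
Qed.

(** Subtracting the combination of the [e j] whose constant coefficients are the coordinates of
    [s x] leaves a section tending to 0, to which the local bound on [l] applies. *)
Lemma frame_coord_cts i s x : W x -> scvg (within W (nbhs x)) s (s x) ->
  (fun y => l i y (s y)) @ within W (nbhs x) --> l i x (s x).
Proof.
move=> Wx sx; have [ll lf ld ec /(_ x Wx)[M hM]] := fr.
have sE : s x = \sum_(j < d) l j x (s x) *: e j x.
  apply/eqP; rewrite -subr_eq0; apply/eqP; apply: lf => // m.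
  rewrite frame_coordB// frame_coord_sum// (bigD1 m)//= ld// eqxx mulr1.
  by rewrite big1 ?addr0 ?subrr// => j jm; rewrite ld// eq_sym (negPf jm) mulr0.
pose u y := s y - \sum_(j < d) l j x (s x) *: e j y.
have ux : scvg (within W (nbhs x)) u (s x - s x).
  apply: scvgB => //; rewrite {2}sE; apply: scvg_sum; first exact: cvg_within.
  by move=> j; apply: scvgZ; [exact: cvg_cst|exact: ec].
apply/cvg_rnormP => r r0.
have M1 : 0 < `|M| + 1 by rewrite ltr_wpDl.
have rM : 0 < r / (`|M| + 1) by rewrite divr_gt0.
have h0 : \forall y \near within W (nbhs x), rnorm (u y) < r / (`|M| + 1).
  by apply: scvg_usc ux _; rewrite subrr rnorm0.
apply: filterS3 hM (withinT _ _) h0 => y hM Wy uy.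
have -> : l i y (s y) - l i x (s x) = l i y (u y).
  rewrite frame_coordB// frame_coord_sum// (bigD1 i)//= ld// eqxx mulr1.
  by rewrite big1 ?addr0// => j ji; rewrite ld// eq_sym (negPf ji) mulr0.
apply: le_lt_trans (hM _ _) _.
apply: (@le_lt_trans _ _ ((`|M| + 1) * rnorm (u y))).
  by rewrite ler_wpM2r ?rnorm_ge0// (le_trans (ler_norm M))// lerDl.
by rewrite mulrC -ltr_pdivlMr.
Qed.

Variable (h : X -> R).
Hypotheses (h_gt0 : forall y, W y -> 0 < h y)
  (h_cts : forall x, W x -> h @ within W (nbhs x) --> h x).

(* The weights conj(l_n) / (|l_n| + |l_0|) make the pivot coordinate of
   the sum [t] of the weighted sections a sum of nonnegative terms. *)
Lemma pivot_section (i0 : 'I_d) (s : nat -> forall y, fiber E y) (C : R) : 0 <= C ->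
  (forall n, cts (s n)) ->
  (forall n y, W y -> rnorm (s n y) <= C * h y / 2 ^+ n) ->
  (forall y, W y -> l i0 y (s 0 y) != 0) ->
  exists t : forall y, fiber E y, [/\ cts t,
    forall y, W y -> rnorm (t y) <= 2 * (C * h y),
    forall n y, W y -> rnorm (l i0 y (s n y)) <= 2 * rnorm (l i0 y (t y)),
    forall y, W y -> l i0 y (t y) != 0 &
    forall i y, W y -> (forall n, l i y (s n y) = 0) -> l i y (t y) = 0].
Proof.
move=> C0 sc sC s0.
pose u n y := rnorm (l i0 y (s n y)).
have u0 n y : 0 <= u n y by exact: rnorm_ge0.
have u00 y : W y -> 0 < u 0 y by move=> Wy; rewrite rnorm_gt0 s0.
pose a n y : R[i]^o := (l i0 y (s n y))^*%C * ((u n y + u 0 y)^-1)%:C.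
have uu n y : W y -> 0 < u n y + u 0 y by move=> Wy; rewrite ltr_wpDl ?u00.
have a1 n y : W y -> rnorm (a n y) <= 1.
  move=> Wy; rewrite rnormM rnorm_conj rnormr ger0_norm.
    by rewrite ler_pdivrMr ?uu// mul1r lerDl.
  by rewrite invr_ge0 ltW// uu.
have uc n x : W x -> u n @ within W (nbhs x) --> u n x.
  by move=> Wx; apply/cvg_rnorm/frame_coord_cts => //; exact: sc.
have ac n x : W x -> a n @ within W (nbhs x) --> a n x.
  move=> Wx; apply: cvgM.
    by apply/cvg_conj/frame_coord_cts => //; exact: sc.
  apply: cvg_real_complex; apply: cvgV; first by rewrite gt_eqF ?uu.
  by apply: cvgD; exact: uc.
pose T m y := \sum_(n < m) a n y *: s n y.
have Tc m : cts (T m).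
  move=> x Wx; apply: scvg_sum; first exact: cvg_within.
  by move=> n; apply: scvgZ; [exact: ac|exact: sc].
have tex y : exists v : fiber E y, W y -> forall n,
    rnorm (v - T n y) <= 2 * (C * h y) / 2 ^+ n.
  have [Wy|nWy] := pselect (W y); last by exists 0.
  have [|v vP] := @geometric_cvg _ _ (T^~ y) (C * h y).
    move=> n; rewrite /T big_ord_recr /= addrAC subrr add0r rnormZ.
    by rewrite (le_trans _ (sC _ _ Wy))// ler_piMl ?rnorm_ge0 ?a1.
  by exists v.
pose t y := sval (cid (tex y)).
have tP y : W y -> forall n, rnorm (t y - T n y) <= 2 * (C * h y) / 2 ^+ n.
  exact: svalP (cid (tex y)).
have lT y : W y -> exists2 M : R, 0 <= M & forall i n,
    rnorm (l i y (t y) - l i y (T n y)) <= M / 2 ^+ n.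
  move=> Wy; have [_ _ _ _ /(_ y Wy)[M hM]] := fr.
  have {}hM : forall v i, rnorm (l i y v) <= M * rnorm v := nbhs_singleton hM Wy.
  exists (`|M| * (2 * (C * h y))).
    by rewrite !mulr_ge0// ltW ?h_gt0.
  move=> i n; rewrite -frame_coordB// (le_trans (hM _ _))//.
  rewrite (@le_trans _ _ (`|M| * rnorm (t y - T n y)))//.
    by rewrite ler_wpM2r ?rnorm_ge0// ler_norm.
  by rewrite -mulrA ler_wpM2l// tP.
pose q n y := u n y ^+ 2 / (u n y + u 0 y).
have q0 n y : W y -> 0 <= q n y.
  by move=> Wy; rewrite divr_ge0 ?sqr_ge0// ltW ?uu.
have lTE n y : W y -> l i0 y (T n y) = (\sum_(j < n) q j y)%:C.
  move=> Wy; rewrite frame_coord_sum// rmorph_sum; apply: eq_bigr => j _.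
  by rewrite /a mulrAC mul_conj_rnorm -rmorphM.
(* The coordinates are bounded on the fibre, so the pivot coordinate of [t] is the limit of those of
   the partial sums [T m], which eventually dominate each term. *)
have qt n y : W y -> q n y <= complex.Re (l i0 y (t y)).
  move=> Wy; rewrite leNgt; apply/negP => tq.
  have [M M0 hM] := lT y Wy.
  have dp : 0 < q n y - complex.Re (l i0 y (t y)) by rewrite subr_gt0.
  have [m hm] := geometric_lt M dp.
  have hM1 := le_trans (rnorm_Re_le _) (hM i0 (n.+1 + m)%N).
  have : q n y <= complex.Re (l i0 y (T (n.+1 + m)%N y)).
    rewrite lTE//= (bigD1 (Ordinal (ltn_addr m (ltnSn n))))//= lerDl.
    by rewrite sumr_ge0// => j _; exact: q0.
  have : M / 2 ^+ (n.+1 + m) <= M / 2 ^+ m.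
    rewrite ler_wpM2l// lef_pV2 ?posrE ?exprn_gt0//.
    by rewrite ler_weXn2l ?ler1n// leq_addl.
  move: hM1; rewrite raddfB /= ler_norml => /andP[+ _].
  lra.
(* Let [v] be the norm of the pivot coordinate of [t]. The terms 0 and [n] give [v >= u_0 / 2] and
   [v >= u_n^2 / (u_n + u_0)]; the second yields [u_n <= 2 v] if [u_n >= u_0], the first
   otherwise. *)
have tu n y : W y -> u n y <= 2 * rnorm (l i0 y (t y)).
  move=> Wy; have h1 := le_trans (qt n y Wy) (le_trans (ler_norm _) (rnorm_Re_le _)).
  have h2 := le_trans (qt 0 y Wy) (le_trans (ler_norm _) (rnorm_Re_le _)).
  have := u00 y Wy; have := u0 n y; have := rnorm_ge0 (l i0 y (t y)).
  have := uu n y Wy; have := uu 0 y Wy.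
  move: h1 h2; rewrite /q; set v := rnorm _; set z := u 0 y; set w := u n y.
  move=> h1 h2 zz wz v0 w0 z0; move: h1 h2; rewrite !ler_pdivrMr// => h1 h2.
  have [wltz|zlew] := ltP w z; nra.
exists t; split.
(* Local boundedness of [h] makes the convergence of [T] to [t] locally uniform. *)
- move=> x Wx; apply: scvg_uniform_limit; first exact: cvg_within.
  move=> r r0; have [m hm] := geometric_lt (2 * (C * (h x + 1))) r0.
  exists (T m); split; first exact: Tc.
    rewrite rdistC (le_lt_trans (tP x Wx m))// (le_lt_trans _ hm)//.
    rewrite ler_wpM2r ?invr_ge0// !ler_wpM2l//.
    by rewrite lerDl.
  have : h x < h x + 1 by rewrite ltrDl.
  move=> /(cvgr_lt _ (h_cts Wx)); apply: filterS2 (withinT _ _) => y Wy hy.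
  rewrite (le_lt_trans (tP y Wy m))// (le_lt_trans _ hm)//.
  rewrite ler_wpM2r ?invr_ge0// !ler_wpM2l//.
  exact: ltW.
- move=> y Wy; have := tP y Wy 0; rewrite /T big_ord0 subr0 expr0 divr1.
  by [].
- by move=> n y; exact: tu.
- move=> y Wy; rewrite -rnorm_gt0; have := tu 0 y Wy; have := u00 y Wy; lra.
move=> i y Wy ls; have [M M0 hM] := lT y Wy.
have lTz n : l i y (T n y) = 0.
  by rewrite frame_coord_sum// big1// => j _; rewrite ls mulr0.
apply/eqP; rewrite -[_ == 0]negbK -rnorm_gt0; apply/negP => lt0.
have [n hn] := geometric_lt M lt0.
have := hM i n; rewrite lTz subr0.
by apply/negP; rewrite -ltNge.
Qed.

(** Induction on the number [k] of coordinates that may be nonzero. In the last of them a pivot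
    section [t] dominates every rescaled [s n], so multiples of [t] with bounded coefficients remove
    this coordinate from all [s n] at once. Each elimination uses up a factor [2 ^+ n] of the decay,
    whence the exponent [k * n]. *)
Lemma section_factorization (k : nat) (s : nat -> forall y, fiber E y) (C : R) :
  (k <= d)%N -> 0 <= C -> (forall n, cts (s n)) ->
  (forall n y (i : 'I_d), W y -> (k <= i)%N -> l i y (s n y) = 0) ->
  (forall n y, W y -> rnorm (s n y) <= C * h y / 2 ^+ (k * n)) ->
  exists (f : nat -> nat -> X -> R[i]^o) (t : nat -> forall y, fiber E y) (B : R),
    [/\ forall n j x, W x -> f n j @ within W (nbhs x) --> f n j x,
      forall n j y, W y -> rnorm (f n j y) <= B,
      forall j, cts (t j),
      forall j y, W y -> rnorm (t j y) <= B * h y &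
      forall n y, W y -> s n y = \sum_(j < k) f n j y *: t j y].
Proof.
have [ll lf ld ec lb] := fr.
elim: k s C => [|k ih] s C kd C0 sc sl sC.
  exists (fun _ _ _ => 0), (fun _ _ => 0), 0; split.
  - by move=> n j x Wx; exact: cvg_cst.
  - by move=> n j x Wx; rewrite rnorm0.
  - move=> j x Wx; apply: scvg0; first exact: cvg_within.
    by move=> e1 e0; apply: nearW => y; rewrite rnorm0.
  - by move=> j x Wx; rewrite rnorm0 mul0r.
  move=> n y Wy; rewrite big_ord0; apply: lf => // i; exact: sl.
pose i0 := Ordinal kd.
(* This factor brings the norm of the frame vector below [h] and keeps its pivot coordinate
   positive. *)
pose r0 y := h y / (1 + rnorm (e i0 y)).
have en y : 0 < 1 + rnorm (e i0 y) by rewrite ltr_pwDl ?rnorm_ge0.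
(* The frame vector becomes term 0, so that the pivot coordinate of the first term never vanishes;
   the rescaled [s m] retain just the decay [1 / 2 ^+ m] that sums the series. *)
pose g n y : fiber E y := if n is m.+1 then (2 ^+ (k * m))%:C *: s m y
                          else (r0 y)%:C *: e i0 y.
have r0c x : W x -> r0 @ within W (nbhs x) --> r0 x.
  move=> Wx; apply: cvgM; first exact: h_cts.
  apply: cvgV; first by rewrite gt_eqF.
  by apply: cvgD; [exact: cvg_cst|exact: (scvg_norm E_F (ec i0 x Wx))].
(* In the constant, [2 * C] accounts for the shift of index and 1 for term 0. *)
have [|n|n y Wy|y Wy|t [tc tC tg tn tl]] := @pivot_section i0 g (2 * C + 1).
- by rewrite addr_ge0// mulr_ge0.
- case: n => [|n] x Wx /=; apply: scvgZ.
  + by apply: cvg_real_complex; exact: r0c.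
  + exact: ec.
  + exact: cvg_cst.
  + exact: sc.
- case: n => [|n] /=.
    rewrite expr0 divr1 rnormZ rnormr gtr0_norm ?divr_gt0 ?h_gt0//.
    rewrite /r0 mulrAC ler_pdivrMr//.
    have h0 := ltW (h_gt0 Wy); have e0 := rnorm_ge0 (e i0 y).
    have p1 := mulr_ge0 C0 h0; have p2 := mulr_ge0 p1 e0; have p3 := mulr_ge0 h0 e0.
    lra.
  rewrite rnormZ rnormr ger0_norm ?exprn_ge0//.
  rewrite (le_trans (ler_wpM2l _ (sC n y Wy))) ?exprn_ge0//.
  rewrite mulSn exprD exprS.
  have a0 : 0 < 2 ^+ n :> R by rewrite exprn_gt0.
  have b0 : 0 < 2 ^+ (k * n) :> R by rewrite exprn_gt0.
  set a := 2 ^+ n in a0 *; set b := 2 ^+ (k * n) in b0 *.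
  have -> : b * (C * h y / (a * b)) = C * h y / a by field; rewrite !gt_eqF.
  have -> : (2 * C + 1) * h y / (2 * a) = C * h y / a + h y / (2 * a).
    by field; rewrite gt_eqF.
  by rewrite lerDl divr_ge0 ?mulr_ge0 ?(ltW a0) ?(ltW (h_gt0 Wy)).
- rewrite /= frame_coordZ// ld// eqxx mulr1 fmorph_eq0 gt_eqF// divr_gt0//.
  exact: h_gt0.
pose c n y : R[i]^o := l i0 y (g n.+1 y) / l i0 y (t y).
have c2 n y : W y -> rnorm (c n y) <= 2.
  move=> Wy; rewrite /c rnormM rnormV ler_pdivrMr ?rnorm_gt0 ?tn//.
  exact: tg.
pose w n : R[i]^o := ((2 ^+ (k * n))^-1)%:C.
pose s' n y := s n y - (w n * c n y) *: t y.
have cc n x : W x -> c n @ within W (nbhs x) --> c n x.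
  move=> Wx; apply: cvgM.
    apply: frame_coord_cts => //; apply: scvgZ; [exact: cvg_cst|exact: sc].
  by apply: cvgV; [exact: tn|apply: frame_coord_cts => //; exact: tc].
(* The added constant bounds the subtracted term: 2 comes from [c n], [2 * (2 * C + 1)] from [t],
   and the decay [1 / 2 ^+ (k * n)] from [w n]. *)
have [||n x Wx|n y i Wy ki|n y Wy|f [t' [B [fc fB tc' tB sE]]]] :=
  ih s' (C + 4 * (2 * C + 1)).
- exact: ltnW.
- by rewrite addr_ge0// mulr_ge0// addr_ge0// mulr_ge0.
- apply: scvgB; first exact: sc.
  apply: scvgZ; last exact: tc.
  by apply: cvgM; [exact: cvg_cst|exact: cc].
- rewrite frame_coordB// frame_coordZ//.
  have [ik|ik] := eqVneq i i0.
    rewrite ik -mulrA /c divfK ?tn//= frame_coordZ// /w fmorphV mulKf ?subrr//.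
    by rewrite fmorph_eq0 gt_eqF// exprn_gt0.
  have {}ki : (k < i)%N.
    by rewrite ltn_neqAle ki andbT; apply: contra_neq ik => ik; apply: val_inj.
  (* Beyond the pivot every [g n] has coordinate 0, hence so does [t], and the earlier eliminations
     are not undone. *)
  rewrite sl// tl ?mulr0 ?subrr// => -[|m] /=; rewrite frame_coordZ//.
    by rewrite ld// (negPf ik) mulr0.
  by rewrite sl ?mulr0.
- rewrite /s' (le_trans (rnormB_le _ _))// rnormZ rnormM /w rnormr.
  rewrite ger0_norm ?invr_ge0 ?exprn_ge0//.
  have h0 := ltW (h_gt0 Wy).
  have w0 : 0 <= (2 ^+ (k * n))^-1 :> R by rewrite invr_ge0 exprn_ge0.
  have h1 : rnorm (s n y) <= C * h y / 2 ^+ (k * n).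
    rewrite (le_trans (sC n y Wy))// ler_wpM2l ?mulr_ge0//.
    rewrite lef_pV2 ?posrE ?exprn_gt0// ler_weXn2l ?ler1n//.
    by rewrite leq_mul2r leqnSn orbT.
  have h2 : rnorm (c n y) * rnorm (t y) <= 2 * (2 * ((2 * C + 1) * h y)).
    by rewrite ler_pM ?rnorm_ge0 ?c2 ?tC.
  rewrite (mulrDl _ _ (h y)) mulrDl lerD// -mulrA mulrC ler_wpM2r//.
  by rewrite (le_trans h2)//; lra.
exists (fun n j y => if j == k then w n * c n y else f n j y),
  (fun j y => if j == k then t y else t' j y), (`|B| + (2 * (2 * C + 1) + 2)).
split.
- move=> n j x Wx; case: ifP => _; last exact: fc.
  by apply: cvgM; [exact: cvg_cst|exact: cc].
- move=> n j y Wy; case: ifP => _.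
    rewrite rnormM /w rnormr ger0_norm ?invr_ge0 ?exprn_ge0//.
    have w1 : (2 ^+ (k * n))^-1 <= 1 :> R by rewrite invf_le1 ?exprn_gt0// exprn_ege1// ler1n.
    rewrite (le_trans (ler_piMl (rnorm_ge0 _) w1))// (le_trans (c2 n y Wy))//.
    have := normr_ge0 B; lra.
  by have := fB n j y Wy; have := ler_norm B; lra.
- move=> j x Wx; case: ifP => _; [exact: tc|exact: tc'].
- move=> j y Wy; have h0 := ltW (h_gt0 Wy); have Ch := mulr_ge0 C0 h0; case: ifP => _.
    have := tC y Wy; have := mulr_ge0 (normr_ge0 B) h0; lra.
  have := tB j y Wy; have := ler_wpM2r h0 (ler_norm B); lra.
move=> n y Wy; rewrite big_ord_recr /= eqxx.
under eq_bigr => j _ do rewrite (ltn_eqF (ltn_ord j)).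
by rewrite -sE// /s' subrK.
Qed.

End factorization.

(** * Scalar functions: Tietze extension and uniformly convergent series *)

Lemma complex_tietze {R : realType} {X : topologicalType} (K : set X)
    (f : X -> R[i]^o) (M : R) : normal_space X -> closed K -> 0 < M ->
  (forall x, K x -> f @ within K (nbhs x) --> f x) ->
  (forall x, K x -> rnorm (f x) <= M) ->
  exists g : continuousType X R[i]^o, (forall x, K x -> g x = f x) /\
    forall x, rnorm (g x) <= 2 * M.
Proof.
move=> nX clK M0 fc fM.
(* Real and imaginary parts are extended separately, each with bound [M], hence the final
   [2 * M]. *)
have [||g1 [g1f g1c g1M]] := @continuous_bounded_extension X R nX K clK
    (fun x => complex.Re (f x)) M M0.
- apply/subspace_continuousP => x Kx; apply/cvgrPdist_lt => e e0.
  have h : \forall y \near within K (nbhs x), rnorm (f y - f x) < e.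
    exact: ((cvg_rnormP _ _).1 (fc x Kx) e e0).
  apply: filterS h => y.
  by apply: le_lt_trans; rewrite distrC -raddfB rnorm_Re_le.
- by move=> x Kx; rewrite (le_trans (rnorm_Re_le _))// fM.
have [||g2 [g2f g2c g2M]] := @continuous_bounded_extension X R nX K clK
    (fun x => complex.Im (f x)) M M0.
- apply/subspace_continuousP => x Kx; apply/cvgrPdist_lt => e e0.
  have h : \forall y \near within K (nbhs x), rnorm (f y - f x) < e.
    exact: ((cvg_rnormP _ _).1 (fc x Kx) e e0).
  apply: filterS h => y.
  by apply: le_lt_trans; rewrite distrC -raddfB rnorm_Im_le.
- by move=> x Kx; rewrite (le_trans (rnorm_Im_le _))// fM.
pose g x : R[i]^o := (g1 x) +i* (g2 x).
have gc : continuous g.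
  move=> x; have -> : g = fun y => (g1 y)%:C + 'i%C * (g2 y)%:C.
    apply/funext => y; rewrite /g; apply/eqP; rewrite eq_complex /=.
    by apply/andP; split; apply/eqP; ring.
  apply: (@cvgD R[i] R[i]^o).
    by apply: cvg_real_complex; exact: g1c.
  apply: (@cvgM R[i]); first exact: cvg_cst.
  by apply: cvg_real_complex; exact: g2c.
exists (mkcts gc); split => x /=.
  by move=> Kx; rewrite -[LHS]/(g x) /g -g1f ?inE// -g2f ?inE//; case: (f x).
rewrite -[mkcts gc x]/(g x) (le_trans (rnorm_le_ReIm _))//= mulr2n mulrDl mul1r.
by rewrite lerD.
Qed.

(** The geometric bound makes the partial sums converge uniformly, and nonnegativity makes the sum
    of the series their supremum. *)
Lemma weighted_sum_cts {R : realType} {X : topologicalType} (a : nat -> X -> R) :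
  (forall n y, 0 <= a n y) -> (forall n y, a n y <= 1 / 2 ^+ n) ->
  (forall n, continuous (a n)) ->
  exists H : X -> R, [/\ continuous H, forall n y, a n y <= H y,
    forall y, H y <= 2 & forall y, (forall n, a n y = 0) -> H y = 0].
Proof.
move=> a0 a1 ac.
pose P m y := \sum_(n < m) a n y.
have Pc m : continuous (P m).
  by move=> x; apply: (@cvg_sum R R^o) => i; exact: ac.
have Pmono n m y : P n y <= P (n + m)%N y.
  by rewrite /P big_split_ord /= lerDl sumr_ge0.
have Ptail n m y : P (n + m)%N y <= P n y + (2 / 2 ^+ n - 2 / 2 ^+ (n + m)).
  elim: m => [|m ih]; first by rewrite addn0 subrr addr0.
  rewrite addnS {1}/P big_ord_recr /= -/(P (n + m)%N y).
  by have := a1 (n + m)%N y; rewrite exprS invfM; lra.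
have Pub n m y : P m y <= P n y + 2 / 2 ^+ n.
  rewrite (le_trans (Pmono m n y))// addnC (le_trans (Ptail n m y))//.
  by rewrite lerD2l gerBl divr_ge0.
pose H y := sup [set P m y | m in [set: nat]].
have HP y n : `|H y - P n y| <= 2 / 2 ^+ n.
  have h1 : P n y <= H y.
    by apply: ub_le_sup; [exists (P 0 y + 2 / 2 ^+ 0) => _ [m _ <-]|exists n].
  rewrite ger0_norm ?subr_ge0// lerBlDl; apply: ge_sup; first by exists (P 0 y), 0.
  by move=> _ [m _ <-].
exists H; split.
- move=> x; apply/cvgrPdist_lt => e e0.
  have e3 : 0 < e / 3 by rewrite divr_gt0.
  have [m hm] := geometric_lt 2 e3.
  have /cvgrPdist_lt/(_ _ e3) := Pc m x; apply: filterS => y.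
  have := HP x m; have := HP y m.
  rewrite !ler_norml !ltr_norml => /andP[? ?] /andP[? ?] /andP[? ?].
  by apply/andP; split; lra.
- move=> n y; rewrite leNgt; apply/negP; rewrite -subr_gt0 => dp.
  have [m hm] := geometric_lt 2 dp.
  have : a n y <= P (n.+1 + m)%N y.
    rewrite /P (bigD1 (Ordinal (ltn_addr m (ltnSn n))))//= lerDl.
    by rewrite sumr_ge0.
  have : 2 / 2 ^+ (n.+1 + m) <= 2 / 2 ^+ m :> R.
    rewrite ler_wpM2l// lef_pV2 ?posrE ?exprn_gt0//.
    by rewrite ler_weXn2l ?ler1n// leq_addl.
  have := HP y (n.+1 + m)%N; rewrite ler_norml => /andP[? ?].
  lra.
- move=> y; have := HP y 0; rewrite /P big_ord0 subr0 expr0 divr1.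
  by apply: le_trans; exact: ler_norm.
move=> y ay; apply/eqP; rewrite -[_ == 0]negbK -normr_gt0; apply/negP => Hy.
have [n hn] := geometric_lt 2 Hy.
have := HP y n; rewrite /P big1 ?subr0 => [|i _]; last exact: ay.
by apply/negP; rewrite -ltNge.
Qed.

(** * Extension by zero from the part of [K] where [h] is positive *)

Section glue.
Context {R : realType} {X : topologicalType}.
Variables (K W : set X) (h : X -> R) (B : R).
Hypotheses (hc : continuous h) (WK : forall y, W y <-> K y /\ 0 < h y).
Hypothesis (h_ge0 : forall y, 0 <= h y).

(** Since [W] is relatively open in [K], limits along [W] at its points are limits along [K]. *)
Let sub x : W x -> within K (nbhs x) `=>` within W (nbhs x).
Proof.
move=> /WK[Kx hx] A WA; have {}WA : \forall y \near x, W y -> A y := WA.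
suff : \forall y \near x, K y -> A y by [].
have h0 : \forall y \near x, 0 < h y by exact: (cvgr_gt (h x) (@hc x)).
apply: filterS2 WA h0 => y WA hy Ky.
by apply: WA; rewrite WK.
Qed.

(** Here [h] vanishes, so whatever is bounded by [B * h] extends continuously by 0. *)
Let small x : K x -> ~ W x -> forall e : R, 0 < e ->
  \forall y \near within K (nbhs x), `|B| * h y < e.
Proof.
move=> Kx nWx e e0; have hx : h x = 0.
  apply/eqP; rewrite eq_le h_ge0 andbT leNgt; apply/negP => hx.
  by apply: nWx; rewrite WK.
have B1 : 0 < `|B| + 1 by rewrite ltr_wpDl.
have eB : h x < e / (`|B| + 1) by rewrite hx divr_gt0.
have hn : \forall y \near x, `|B| * h y < e.
  apply: filterS (cvgr_lt _ (@hc x) _ eB) => y; rewrite ltr_pdivlMr// mulrC.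
  by apply: le_lt_trans; rewrite ler_wpM2r// lerDl.
by apply: filterS hn => y.
Qed.

Lemma glue_scvg (E : banach_bundle R X) (t : forall y, fiber E y) :
  (forall x, W x -> scvg (within W (nbhs x)) t (t x)) ->
  (forall y, W y -> rnorm (t y) <= B * h y) ->
  forall x, K x -> scvg (within K (nbhs x))
    (fun y => if `[< W y >] then t y else 0) (if `[< W x >] then t x else 0).
Proof.
move=> tc tB x Kx; case: asboolP => [Wx|nWx].
  apply: scvg_sub (sub Wx) _; apply: scvg_near (tc x Wx).
  by apply: filterS (withinT _ _) => y Wy; rewrite asboolT.
apply: scvg0 => [|e e0]; first exact: cvg_within.
apply: filterS (small Kx nWx e0) => y; apply: le_lt_trans.
case: asboolP => [Wy|_]; last by rewrite rnorm0 mulr_ge0.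
by rewrite (le_trans (tB y Wy))// ler_wpM2r// ler_norm.
Qed.

Lemma glue_cvg (f : X -> R[i]^o) :
  (forall x, W x -> f @ within W (nbhs x) --> f x) ->
  (forall y, W y -> rnorm (f y) <= B * h y) ->
  forall x, K x -> (fun y => if `[< W y >] then f y else 0) @ within K (nbhs x) -->
    (if `[< W x >] then f x else 0).
Proof.
move=> fc fB x Kx; apply/cvg_rnormP => e e0; case: asboolP => [Wx|nWx].
  apply: (sub Wx); apply: filterS2 ((cvg_rnormP _ _).1 (fc x Wx) e e0) (withinT _ _).
  by move=> y fy Wy; rewrite asboolT.
apply: filterS (small Kx nWx e0) => y; apply: le_lt_trans; rewrite subr0.
case: asboolP => [Wy|_]; last by rewrite rnorm0 mulr_ge0.
by rewrite (le_trans (fB y Wy))// ler_wpM2r// ler_norm.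
Qed.

End glue.
(** * Automatic continuity *)

Lemma linear_rnorm_cts {R : realType} (V W : normedModType R[i])
    (f : {linear V -> W}) (B : R) :
  (forall v, rnorm (f v) <= B * rnorm v) -> continuous f.
Proof.
move=> fB; apply/bounded_linear_continuous/linear_boundedP.
exists B%:C; split; first by rewrite complex_real.
move=> r Br v; rewrite (@le_trans _ _ (B%:C * `|v|))//.
  by rewrite -!rnormE -rmorphM lecR.
by rewrite ler_wpM2r// ltW.
Qed.

Section automatic_continuity.
Context {R : realType} {X : topologicalType} (cX : compact [set: X])
  (hX : hausdorff_space X) (E : banach_bundle R X).
Hypothesis (E_F : is_F_bundle E).
Variables (V : completeNormedModType R[i]) (M : banach_module X V)
  (phi : {linear Gamma cX E -> V}).
Hypothesis (phi_CX : forall (f : continuousType X R[i]^o) (s : Gamma cX E),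
  phi (Gamma_mul f s) = mod_act M f (phi s)).

Local Notation at_ s x := ((s : csection E) x).

Definition bounded_on (Z : set X) : Prop := exists B : R,
  forall s : Gamma cX E, (forall y, Z y -> at_ s y = 0) ->
    rnorm (phi s) <= B * Gamma_norm s.

Lemma Gamma_sum_at (I : Type) (r : seq I) (G : I -> Gamma cX E) y :
  at_ (\sum_(i <- r) G i) y = \sum_(i <- r) at_ (G i) y.
Proof. by elim: r => [|i r ih]; rewrite ?big_nil// !big_cons -ih. Qed.

Lemma GammaB_at (s t : Gamma cX E) y : at_ (s - t) y = at_ s y - at_ t y.
Proof. by rewrite -[in RHS]scaleN1r. Qed.

Lemma sup_norm_le (f : continuousType X R[i]^o) (c : R) : 0 <= c ->
  (forall x, rnorm (f x) <= c) -> sup_norm f <= c.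
Proof.
move=> c0 fc; rewrite /sup_norm.
have [->|/set0P ne] := eqVneq [set rnorm (f x) | x in setT] set0.
  by rewrite sup0.
by apply: ge_sup => // _ [x _ <-].
Qed.

(** The difference of [u n] and the combination vanishes on [K] and has bounded norm, so boundedness
    on [K] controls it. On the combination, [C(X)]-linearity moves the coefficients out of [phi],
    where the module norm inequality bounds them; only the fixed vectors [phi (T j)] remain. *)
Lemma bounded_on_uniform (K : set X) (d : nat) (c : R)
    (F : nat -> nat -> continuousType X R[i]^o) (T : nat -> Gamma cX E)
    (u : nat -> Gamma cX E) :
  bounded_on K -> 0 <= c -> (forall n j x, rnorm (F n j x) <= c) ->
  (forall n, Gamma_norm (u n) <= 1) ->
  (forall n y, K y -> at_ (u n) y = \sum_(j < d) F n j y *: at_ (T j) y) ->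
  exists D : R, forall n, rnorm (phi (u n)) <= D.
Proof.
move=> [B KB] c0 Fc u1 uE.
pose D1 := 1 + \sum_(j < d) c * Gamma_norm (T j).
pose D2 := \sum_(j < d) c * rnorm (phi (T j)).
exists (`|B| * D1 + D2) => n.
pose w := \sum_(j < d) Gamma_mul (F n j) (T j).
have wE y : at_ w y = \sum_(j < d) F n j y *: at_ (T j) y by exact: Gamma_sum_at.
have rK y : K y -> at_ (u n - w) y = 0.
  by move=> Ky; rewrite GammaB_at wE uE// subrr.
have rN : Gamma_norm (u n - w) <= D1.
  apply: Gamma_norm_le => [|y].
    by rewrite addr_ge0// sumr_ge0// => j _; rewrite mulr_ge0// Gamma_norm_ge0.
  rewrite GammaB_at (le_trans (rnormB_le _ _))// lerD//.
    by rewrite (le_trans (rnorm_le_Gamma_norm _ _)).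
  rewrite wE (le_trans (rnorm_sum_le _ _ _))//; apply: ler_sum => j _.
  by rewrite rnormZ ler_pM ?rnorm_ge0// rnorm_le_Gamma_norm.
rewrite -[u n](subrK w) raddfD (le_trans (rnormD _ _))// lerD//.
  rewrite (le_trans (KB _ rK))// (@le_trans _ _ (`|B| * Gamma_norm (u n - w)))//.
    by rewrite ler_wpM2r ?Gamma_norm_ge0// ler_norm.
  by rewrite ler_wpM2l.
rewrite raddf_sum (le_trans (rnorm_sum_le _ _ _))//; apply: ler_sum => j _.
apply: (@le_trans _ _ (rnorm (mod_act M (F n j) (phi (T j))))).
  by rewrite -phi_CX; exact: lexx.
rewrite (le_trans (mod_act_norm _ _ _))// ler_wpM2r ?rnorm_ge0//.
exact: sup_norm_le.
Qed.

(** Since [n%:R * c ^+ n] is not a bound on [Z], some section violates it, and is rescaled to the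
    required norm. *)
Lemma unbounded_on_sequence (Z : set X) (c : R) : 0 < c -> ~ bounded_on Z ->
  exists u : nat -> Gamma cX E, forall n, [/\ forall y, Z y -> at_ (u n) y = 0,
    Gamma_norm (u n) = (c ^+ n)^-1 & n%:R < rnorm (phi (u n))].
Proof.
move=> c0 nZ.
suff /choice[u uP] : forall n, exists s : Gamma cX E,
    [/\ forall y, Z y -> at_ s y = 0,
      Gamma_norm s = (c ^+ n)^-1 & n%:R < rnorm (phi s)] by exists u.
move=> n; apply: contrapT => nex; apply: nZ; exists (n%:R * c ^+ n) => s sZ.
rewrite leNgt; apply/negP => sn; apply: nex.
have s0 : 0 < Gamma_norm s.
  rewrite lt_neqAle Gamma_norm_ge0 andbT eq_sym; apply/eqP => s0.
  have s00 : s = 0 by apply: Gamma_norm_eq0; rewrite s0.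
  by move: sn; rewrite s0 mulr0 s00 linear0 rnorm0 ltxx.
have cn : 0 < c ^+ n by rewrite exprn_gt0.
pose a := (Gamma_norm s * c ^+ n)^-1.
have a0 : 0 < a by rewrite invr_gt0 mulr_gt0.
have aN : rnorm (a%:C : R[i]^o) = a by rewrite rnormr gtr0_norm.
have NZ : Gamma_norm (a%:C *: s) = a * Gamma_norm s.
  apply: (@complexI R); rewrite (Gamma_normZ a%:C s) rmorphM; congr (_ * _).
  by rewrite -[RHS](congr1 (real_complex R) aN) rnormE.
exists (a%:C *: s); split.
- by move=> y Zy; rewrite [LHS]csectionZ sZ// scaler0.
- by rewrite NZ /a invfM mulrAC mulVf ?mul1r// gt_eqF.
rewrite linearZ rnormZ aN /a -ltr_pdivrMl// invrK.
by apply: le_lt_trans sn; rewrite le_eqVlt; apply/orP; left; apply/eqP; ring.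
Qed.

Lemma bounded_on_step (Z K : set X) d (e : 'I_d -> forall y, fiber E y) l :
  closed K -> dual_frames (K `\` Z) e l -> bounded_on K -> bounded_on Z.
Proof.
move=> clK fr Kb; apply: contrapT => nZ.
have c0 : 0 < 2 ^+ d.+1 :> R by rewrite exprn_gt0.
have [u uP] := unbounded_on_sequence c0 nZ.
(* Of the decay [1 / 2 ^+ (d.+1 * n)] of [u n], a factor [1 / 2 ^+ n] makes the series converge; the
   rest is spent on the [d] eliminations. *)
pose a n y := 2 ^+ (d * n) * rnorm (at_ (u n) y).
have a0 n y : 0 <= a n y by rewrite mulr_ge0 ?rnorm_ge0.
have a1 n y : a n y <= 1 / 2 ^+ n.
  rewrite ler_pdivlMr ?exprn_gt0// /a mulrAC -exprD.
  rewrite -[X in 2 ^+ (_ + X)]mul1n -mulnDl addn1.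
  rewrite -ler_pdivlMl ?exprn_gt0// mulr1 exprM.
  by have [_ <- _] := uP n; exact: rnorm_le_Gamma_norm.
have ac n : continuous (a n).
  move=> x; apply: cvgM; first exact: cvg_cst.
  exact: (scvg_norm E_F (@section_cts _ _ _ (u n) x)).
have [H [Hc aH H2 H0]] := weighted_sum_cts a0 a1 ac.
have Hge0 y : 0 <= H y by rewrite (le_trans (a0 0 y)).
(* With the square root, the norm of [u n] is at most [h ^+ 2 / 2 ^+ (d * n)], so the quotient by
   [h] still has the bound [h / 2 ^+ (d * n)] that the factorization requires. *)
pose h (y : X) : R := Num.sqrt (H y).
have hh y : h y * h y = H y by rewrite -expr2 sqr_sqrtr.
have h0 y : 0 <= h y by rewrite sqrtr_ge0.
have h2 y : h y <= 2.
  rewrite leNgt; apply/negP => h2; have := H2 y; rewrite -hh; nra.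
have hc : continuous h.
  by move=> x; apply: continuous_comp; [exact: Hc|exact: sqrt_continuous].
pose W : set X := [set y | K y /\ 0 < h y].
(* All [u n] vanish on [Z], hence so does [h], and the frame over [K] minus [Z] is available on
   [W]. *)
have WKZ : W `<=` K `\` Z.
  move=> y [Ky hy]; split=> // Zy; move: hy.
  have -> : h y = 0.
    by rewrite /h H0 ?sqrtr0// => n; have [uZ _ _] := uP n; rewrite /a uZ// rnorm0 mulr0.
  by rewrite ltxx.
have Wh y : W y -> 0 < h y by case.
have hcW x : W x -> h @ within W (nbhs x) --> h x.
  by move=> _; apply: cvg_trans (hc x); apply: cvg_app; exact: cvg_within.
pose s n y := ((h y)^-1)%:C *: at_ (u n) y.
have [||n y i _|n y Wy|f [t [B [fc fB tc tB sE]]]] :=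
    @section_factorization R X E cX hX E_F W d e l (dual_framesS WKZ fr) h Wh hcW
      d s 1 (leqnn d).
- by [].
- move=> n x Wx; apply: scvgZ.
    apply: cvg_real_complex; apply: cvgV; last exact: hcW.
    by rewrite gt_eqF// Wh.
  by apply: scvg_sub (@section_cts _ _ _ (u n) x); exact: cvg_within.
- by rewrite leqNgt ltn_ord.
- rewrite rnormZ rnormr gtr0_norm ?invr_gt0 ?Wh// mul1r ler_pdivrMl ?Wh//.
  by rewrite mulrA hh ler_pdivlMr ?exprn_gt0// mulrC; exact: aH.
have WE y : W y <-> K y /\ 0 < h y by [].
(* The factor [h] of [u n = h *: s n] goes to the coefficients: [f n j] is merely bounded, while its
   product with [h] can be extended by 0. *)
pose F' n j y : R[i]^o := (h y)%:C * f n j y.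
have F'c n j x : W x -> F' n j @ within W (nbhs x) --> F' n j x.
  move=> Wx; apply: cvgM; last exact: fc.
  by apply: cvg_real_complex; exact: hcW.
have F'B n j y : W y -> rnorm (F' n j y) <= B * h y.
  move=> Wy; rewrite rnormM rnormr ger0_norm// mulrC ler_wpM2r//.
  exact: fB.
pose M0 := 2 * `|B| + 1.
have M00 : 0 < M0 by rewrite ltr_wpDl ?mulr_ge0.
have BM y : B * h y <= M0.
  have := ler_wpM2r (h0 y) (ler_norm B); have := ler_wpM2l (normr_ge0 B) (h2 y).
  by rewrite /M0; lra.
have nX := compact_normal hX cX.
have Gex n j : exists g : continuousType X R[i]^o,
    (forall x, K x -> g x = if `[< W x >] then F' n j x else 0) /\
    forall x, rnorm (g x) <= 2 * M0.
  apply: complex_tietze => //.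
    exact: (glue_cvg hc WE h0 (F'c n j) (F'B n j)).
  move=> x Kx; case: asboolP => [Wx|_]; last by rewrite rnorm0 ltW.
  exact: le_trans (F'B n j x Wx) (BM x).
have Tex j : exists r : csection E,
    forall y, K y -> r y = if `[< W y >] then t j y else 0.
  apply: (csection_extension cX hX clK (M := M0)); first exact: ltW.
    exact: (glue_scvg hc WE h0 (tc j) (tB j)).
  move=> x Kx; case: asboolP => [Wx|_]; last by rewrite rnorm0 ltW.
  exact: le_trans (tB j x Wx) (BM x).
pose G n j := sval (cid (Gex n j)); have GP n j := svalP (cid (Gex n j)).
pose T j : Gamma cX E := sval (cid (Tex j)); have TP j := svalP (cid (Tex j)).
have [|n j x|n|n y Ky|D uD] := @bounded_on_uniform K d (2 * M0) G T u Kb.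
- by rewrite mulr_ge0// ltW.
- by have [_] := GP n j; apply.
- have [_ -> _] := uP n; rewrite invf_le1 ?exprn_gt0//.
  by rewrite exprn_ege1// exprn_ege1// ler1n.
- have -> : \sum_(j < d) G n j y *: at_ (T j) y = \sum_(j < d)
      (if `[< W y >] then F' n j y else 0) *: (if `[< W y >] then t j y else 0).
    by apply: eq_bigr => j _; rewrite -(TP j y Ky) -((GP n j).1 y Ky).
  case: asboolP => [Wy|nWy].
    have -> : at_ (u n) y = (h y)%:C *: s n y.
      by rewrite /s scalerA -rmorphM mulfV ?gt_eqF ?Wh// scale1r.
    by rewrite sE// scaler_sumr; apply: eq_bigr => j _; rewrite scalerA.
  (* On [K] outside [W] both sides vanish, because [a n y <= H y = 0]. *)
  rewrite big1 => [|j _]; last by rewrite scale0r.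
  have hy : h y = 0.
    apply/eqP; rewrite eq_le h0 andbT leNgt; apply/negP => hy; exact: nWy.
  have := aH n y; rewrite -hh hy mulr0 /a pmulr_rle0 ?exprn_gt0// => uy.
  by apply: rnorm_eq0; apply/eqP; rewrite eq_le uy rnorm_ge0.
have [_ _] := uP (Num.bound `|D|).
apply/negP; rewrite -leNgt (le_trans (uD _))// (le_trans (ler_norm D))//.
by rewrite ltW// archi_boundP.
Qed.

Lemma bounded_onS (Z K : set X) : K `<=` Z -> bounded_on K -> bounded_on Z.
Proof. by move=> KZ [B KB]; exists B => s sZ; apply: KB => y /KZ /sZ. Qed.

(** The trivializing sets are removed one at a time, so that each application of [bounded_on_step]
    meets a single frame. *)
Lemma bounded_on_stratum d : subhomogeneous E -> conditionally_finite_type E ->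
  bounded_on (dim_lt_set E d.+1) -> bounded_on (dim_lt_set E d).
Proof.
move=> E_sub E_cft bd; have [n [U [UO Ucov Utriv]]] := E_cft d.
have Oex i : exists O, open O /\ U i = dim_eq_set E d `&` O.
  by have [Q ? ?] := UO i; exists Q.
pose O i := sval (cid (Oex i)).
have Oo i : open (O i) by have [] := svalP (cid (Oex i)).
have UE i : U i = dim_eq_set E d `&` O i by have [] := svalP (cid (Oex i)).
have ltP y : dim_lt_set E d.+1 y -> dim_lt_set E d y \/ dim_eq_set E d y.
  move=> [k]; rewrite ltnS leq_eqVlt => /predU1P[->|kd] yk; first by right.
  by left; exists k.
(* A chain of closed sets from dimension at most [d], at [k = 0], down to dimension less than [d],
   at [k = n]; the points lost at stage [k] lie in the [k]-th trivializing set. *)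
pose Z k := dim_lt_set E d `|` (dim_lt_set E d.+1 `&`
  \bigcap_(i in [set i : 'I_n | (i < k)%N]) ~` O i).
have clZ k : closed (Z k).
  apply: closedU; first exact: closed_dim_lt_set.
  apply: closedI; first exact: closed_dim_lt_set.
  by apply: closed_bigI => i _; exact: open_closedC.
suff /(_ n (leqnn n)) : forall k, (k <= n)%N -> bounded_on (Z k).
  apply: bounded_onS => y [//|[/ltP[//|yd] yO]].
  have [i _ Ui] := Ucov y yd.
  have := yO i (ltn_ord i); rewrite UE in Ui.
  by case: Ui => _ Oy /(_ Oy).
elim=> [|k ih] kn.
  by apply: bounded_onS bd => y yd; right; split.
pose i0 := Ordinal kn.
have [|e [l fr]] := trivial_dual_frames E_F _ (Utriv i0) (d := d).
  by rewrite UE => y [].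
apply: (@bounded_on_step _ (Z k) d e l) (clZ k) _ (ih (ltnW kn)).
apply: dual_framesS fr => y [[yd|[yd yO]] nZ]; first by case: nZ; left.
rewrite UE; split.
  by have [yd'|//] := ltP y yd; case: nZ; left.
apply: contrapT => nO; apply: nZ; right; split => // i /=.
rewrite ltnS leq_eqVlt => /predU1P[ik|ik]; last exact: yO.
by rewrite (_ : i = i0)//; apply: val_inj.
Qed.

Lemma bounded_on_set0_cts : bounded_on set0 -> continuous phi.
Proof. by move=> [B phiB]; apply: (@linear_rnorm_cts _ _ _ phi B) => s; exact: phiB. Qed.

End automatic_continuity.
Theorem theorem3p16 (R : realType) (X : topologicalType)
  (cX : compact [set: X]) (hX : hausdorff_space X)
  (E : banach_bundle R X)
  (E_F : is_F_bundle E)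
  (E_subhom : subhomogeneous E)
  (E_cft : conditionally_finite_type E)
  (E_Gdelta : forall d : nat, Gdelta (dim_le_set E d))
  (V : completeNormedModType R[i]) (M : banach_module X V)
  (phi : {linear Gamma cX E -> V})
  (phi_CX : forall (f : continuousType X R[i]^o) (s : Gamma cX E),
     phi (Gamma_mul f s) = mod_act M f (phi s)) :
  continuous phi.
Proof.
have [N EN] := E_subhom.
(* Descent on the dimension: all fibres have dimension less than [N.+1], so at the start only the
   zero section is concerned, and the end of the descent is the empty set. *)
have strata k : bounded_on phi (dim_lt_set E (N.+1 - k)).
  elim: k => [|k ih].
    exists 0 => s s0; rewrite (_ : s = 0) ?linear0 ?rnorm0 ?mul0r//.
    by apply: csectionP => x; apply: s0; have [m] := EN x; rewrite subn0; exists m.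
  (* Once [k] exceeds [N], truncated subtraction makes both bounds 0 and the set no longer
     changes. *)
  have [kN|Nk] := ltnP k N.+1; last first.
    by move: Nk ih; rewrite -subn_eq0 subnS => /eqP ->.
  apply: (bounded_on_stratum hX E_F phi_CX E_subhom E_cft).
  by rewrite subnS prednK// subn_gt0.
apply: bounded_on_set0_cts.
by apply: bounded_onS (strata N.+1) => x [m]; rewrite subnn.
Qed.
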